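(* Let $n=2^\ell$ with $\ell\in\mathbb{N}$ and let $m=5\ell$. There is a polynomial-time algorithm which, given any matrix $A\in M_n(\mathbb{R})$, computes a matrix $B\in M_{2n}(CL_m)$ such that $|\mathrm{Cdet}_{2n}(B)|^2=\frac{\mathrm{perm}_n(A)^2}{2^\ell}$.
   Context: The real Clifford algebra $CL'_m$ is the $2^m$-dimensional real vector space with basis $\{e_T: T\subseteq[m]\}$, $e_T=e_{i_1}\cdots e_{i_k}$ for $T=\{i_1<\cdots<i_k\}$, with multiplication determined by $e_i^2=1$ and $e_ie_j=-e_je_i$ ($i\neq j$). $CL_m$ is the subalgebra spanned by $e_T$ with $|T|$ even. For $h=\sum_T c_Te_T$, $|h|=\sqrt{\sum_T c_T^2}$. For a matrix $B$ over a ring, $\mathrm{Cdet}_N(B)=\sum_{\sigma\in S_N}\mathrm{sgn}(\sigma)B(1,\sigma(1))\cdots B(N,\sigma(N))$ (row-order products). $\mathrm{perm}_n(A)$ is the usual permanent of the real matrix $A$. *)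

(* Defs.v *)
From HB Require Import structures.
From mathcomp Require Import all_boot all_order all_fingroup all_algebra.
From mathcomp Require Import reals.

Set Implicit Arguments.
Unset Strict Implicit.
Unset Printing Implicit Defensive.

Import Order.TTheory GRing.Theory Num.Theory.
Local Open Scope ring_scope.

Section SymmetricDifference.
Variable T : finType.
Implicit Types A B C : {set T}.

Definition symdiff A B : {set T} := [set x | (x \in A) (+) (x \in B)].

Lemma symdiffA : associative symdiff.
Proof. by move=> A B C; apply/setP=> x; rewrite !inE addbA. Qed.

Lemma symdiffC : commutative symdiff.
Proof. by move=> A B; apply/setP=> x; rewrite !inE addbC. Qed.

Lemma symdiffK A : cancel (symdiff A) (symdiff A).
Proof. by move=> B; apply/setP=> x; rewrite !inE addKb. Qed.

Lemma symdiff0s A : symdiff set0 A = A.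
Proof. by apply/setP=> x; rewrite !inE. Qed.

Lemma symdiffs0 A : symdiff A set0 = A.
Proof. by rewrite symdiffC symdiff0s. Qed.

Lemma symdiffss A : symdiff A A = set0.
Proof. by apply/setP=> x; rewrite !inE addbb. Qed.

Lemma odd_card_symdiff A B : odd #|symdiff A B| = odd #|A| (+) odd #|B|.
Proof.
have -> : symdiff A B = (A :\: B) :|: (B :\: A).
  by apply/setP=> x; rewrite !inE; do 2!case: (x \in _).
rewrite cardsU (_ : (A :\: B) :&: (B :\: A) = set0); last first.
  by apply/setP=> x; rewrite !inE; do 2!case: (x \in _).
rewrite cards0 subn0 oddD -(cardsID B A) -(cardsID A B) !oddD setIC.
by case: (odd #|B :&: A|); case: (odd _); case: (odd _).
Qed.
End SymmetricDifference.

(* [clifford R m] is the algebra CL'_m over R: an element is the family of its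
   coordinates in the basis (e_T), with T ranging over subsets of 'I_m.
   Sorting e_S e_T takes one transposition (factor -1) for every pair
   (i, j) of S x T with j < i, and then e_i e_i = 1 erases the common
   generators, so that e_S e_T = (-1)^(inversions S T) e_(symdiff S T). *)
Definition clifford (R : comNzRingType) (m : nat) : Type :=
  {ffun {set 'I_m} -> R^o}.

HB.instance Definition _ R m := GRing.Lmodule.on (clifford R m).

Section Clifford.
Variables (R : comNzRingType) (m : nat).
Implicit Types (S T U : {set 'I_m}) (x y z : clifford R m).

Definition inversion_set S T : {set 'I_m * 'I_m} :=
  [set p | [&& p.1 \in S, p.2 \in T & (p.2 < p.1)%N]].

Definition inversions S T : nat := #|inversion_set S T|.

Definition csign S T : R := (-1) ^+ inversions S T.

Definition clbasis T : clifford R m := [ffun U => (U == T)%:R].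

Definition clgen (i : 'I_m) : clifford R m := clbasis [set i].

(* For given S and U, [symdiff S U] is the only T with symdiff S T = U. *)
Definition clmul x y : clifford R m :=
  [ffun U => \sum_S csign S (symdiff S U) * x S * y (symdiff S U)].

Lemma csignDl S T U : csign (symdiff S T) U = csign S U * csign T U.
Proof.
rewrite /csign /inversions -exprD -[LHS]signr_odd -[RHS]signr_odd oddD.
rewrite -odd_card_symdiff; congr (_ ^+ odd #|pred_of_set _|).
by apply/setP=> p; rewrite !inE; do 3!case: (_ \in _); case: (_ < _)%N.
Qed.

Lemma csignDr S T U : csign S (symdiff T U) = csign S T * csign S U.
Proof.
rewrite /csign /inversions -exprD -[LHS]signr_odd -[RHS]signr_odd oddD.
rewrite -odd_card_symdiff; congr (_ ^+ odd #|pred_of_set _|).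
by apply/setP=> p; rewrite !inE; do 3!case: (_ \in _); case: (_ < _)%N.
Qed.

Lemma csign0s T : csign set0 T = 1.
Proof.
rewrite /csign /inversions (_ : inversion_set _ _ = set0) ?cards0 //.
by apply/setP=> p; rewrite !inE.
Qed.

Lemma csigns0 S : csign S set0 = 1.
Proof.
rewrite /csign /inversions (_ : inversion_set _ _ = set0) ?cards0 //.
by apply/setP=> p; rewrite !inE andbF.
Qed.

Lemma clmulA : associative clmul.
Proof.
move=> x y z; apply/ffunP=> U; rewrite !ffunE.
under [RHS]eq_bigr => T _ do rewrite ffunE mulr_sumr mulr_suml.
rewrite exchange_big /=; apply: eq_bigr => S _.
rewrite ffunE mulr_sumr (reindex_inj (can_inj (symdiffK S))) /=.
apply: eq_bigr => T _.
have -> : symdiff (symdiff S T) (symdiff S U) = symdiff T U.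
  by rewrite (symdiffC S T) -symdiffA symdiffK.
rewrite !mulrA; congr (_ * _ * _); rewrite csignDl.
have -> : csign S (symdiff S U) * x S * (csign S (symdiff T U)
   * csign T (symdiff T U)) =
   (csign S (symdiff S U) * csign S (symdiff T U)) * csign T (symdiff T U) * x S.
  by rewrite !mulrA [X in X * _](mulrAC) [LHS]mulrAC.
have -> : csign S (symdiff S U) * csign S (symdiff T U) = csign S (symdiff S T).
  by rewrite -csignDr (symdiffC T U) -symdiffA symdiffK.
by rewrite (mulrC (csign S _)).
Qed.

Lemma clmul1l : left_id (clbasis set0) clmul.
Proof.
move=> x; apply/ffunP=> U; rewrite ffunE (bigD1 set0) //= big1 => [|S nS].
  by rewrite !ffunE eqxx symdiff0s csign0s !mul1r addr0.
by rewrite ffunE (negPf nS) mulr0 mul0r.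
Qed.

Lemma clmul1r : right_id (clbasis set0) clmul.
Proof.
move=> x; apply/ffunP=> U; rewrite ffunE (bigD1 U) //= big1 => [|S nS].
  by rewrite !ffunE symdiffss eqxx csigns0 mul1r mulr1 addr0.
rewrite ffunE (_ : (_ == _) = false) ?mulr0 //.
apply/negbTE; apply: contra nS => /eqP E.
by rewrite -(symdiffK S U) E symdiffs0.
Qed.

Lemma clmulDl : left_distributive clmul +%R.
Proof.
move=> x y z; apply/ffunP=> U; rewrite !ffunE -big_split /=.
by apply: eq_bigr => S _; rewrite !ffunE mulrDr mulrDl.
Qed.

Lemma clmulDr : right_distributive clmul +%R.
Proof.
move=> x y z; apply/ffunP=> U; rewrite !ffunE -big_split /=.
by apply: eq_bigr => S _; rewrite !ffunE mulrDr.
Qed.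

Lemma clone_neq0 : clbasis set0 != 0.
Proof.
by apply/eqP=> /ffunP/(_ set0); rewrite !ffunE eqxx => /eqP; rewrite oner_eq0.
Qed.

HB.instance Definition _ := GRing.Zmodule_isNzRing.Build (clifford R m)
  clmulA clmul1l clmul1r clmulDl clmulDr clone_neq0.

Lemma clscaleAl (a : R) x y : a *: (x * y) = a *: x * y.
Proof.
have aux (b c d : R) : a * (b * c * d) = b * (a * c) * d.
  by rewrite !mulrA (mulrC a).
apply/ffunP=> U; rewrite !ffunE scaler_sumr; apply: eq_bigr => S _.
by rewrite !ffunE; apply: aux.
Qed.

HB.instance Definition _ :=
  GRing.Lmodule_isLalgebra.Build R (clifford R m) clscaleAl.

Lemma clscaleAr (a : R) x y : a *: (x * y) = x * (a *: y).
Proof.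
have aux (b c d : R) : a * (b * c * d) = b * c * (a * d).
  by rewrite mulrCA.
apply/ffunP=> U; rewrite !ffunE scaler_sumr; apply: eq_bigr => S _.
by rewrite !ffunE; apply: aux.
Qed.

HB.instance Definition _ :=
  GRing.Lalgebra_isAlgebra.Build R (clifford R m) clscaleAr.

Lemma clbasisM S T :
  clbasis S * clbasis T = csign S T *: clbasis (symdiff S T).
Proof.
apply/ffunP=> U; rewrite !ffunE (bigD1 S) //= big1 => [|S' nS'].
  rewrite !ffunE eqxx mulr1 addr0.
  have -> : (symdiff S U == T) = (U == symdiff S T).
    apply/eqP/eqP => [<-|->]; by rewrite symdiffK.
  by case: eqP => [->|_]; rewrite ?symdiffK //= [RHS]mulr0 mulr0.
by rewrite ffunE (negPf nS') mulr0 mul0r.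
Qed.

Lemma clgen_sqr i : clgen i * clgen i = 1.
Proof.
rewrite clbasisM symdiffss /csign /inversions.
rewrite (_ : inversion_set _ _ = set0) ?cards0 ?scale1r //.
apply/setP=> -[j k]; rewrite !inE /=.
by apply/and3P => -[/eqP-> /eqP->]; rewrite ltnn.
Qed.

Lemma clgen_anticomm i j : i != j -> clgen i * clgen j = - (clgen j * clgen i).
Proof.
wlog lt_ij : i j / (i < j)%N => [H nij|_].
  have: (i != j :> nat) by [].
  rewrite neq_ltn => /orP[/H->//|lt_ji].
  by rewrite (H j i) ?opprK // eq_sym.
rewrite !clbasisM symdiffC /csign /inversions.
rewrite (_ : inversion_set [set i] [set j] = set0); last first.
  apply/setP=> -[k l]; rewrite !inE /=; apply/and3P => -[/eqP-> /eqP->].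
  by rewrite ltnNge ltnW.
rewrite (_ : inversion_set [set j] [set i] = [set (j, i)]); last first.
  apply/setP=> -[k l]; rewrite !inE /= xpair_eqE andbA.
  by case: eqP => [->|//]; case: eqP => [->|//] /=; rewrite lt_ij.
by rewrite cards0 cards1 scale1r expr1 scaleN1r opprK.
Qed.

Lemma clbasis_prod T : clbasis T = \prod_(i <- enum T) clgen i.
Proof.
rewrite -[T in LHS]set_enum.
have : sorted (fun i j : 'I_m => i < j)%N (enum T).
  rewrite {1}/enum_mem; apply: sorted_filter.
    by move=> ? ? ?; apply: ltn_trans.
  have := iota_ltn_sorted 0 m; rewrite -val_enum_ord sorted_map enumT.
  exact: sub_sorted.
elim: (enum T) => [|i s IHs] /= => [_|path_s].
  by rewrite big_nil; congr clbasis; apply/setP=> i; rewrite !inE.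
rewrite big_cons -IHs ?(path_sorted path_s) // clbasisM.
have lt_i : {in s, forall j : 'I_m, (i < j)%N}.
  apply/allP; apply: order_path_min path_s.
  by move=> ? ? ?; apply: ltn_trans.
rewrite /csign /inversions (_ : inversion_set _ _ = set0); last first.
  apply/setP=> -[k l]; rewrite !inE /=; apply/and3P => -[/eqP-> /lt_i].
  by rewrite ltnNge => /negP lt_il /ltnW.
rewrite cards0 scale1r; congr clbasis; apply/setP=> j; rewrite !inE.
by case: eqP => //= ->; apply/esym/negP => /lt_i; rewrite ltnn.
Qed.

Lemma clbasis_sum x : x = \sum_T x T *: clbasis T.
Proof.
apply/ffunP=> U; rewrite sum_ffunE (bigD1 U) //= big1 => [|T nT].
  by rewrite !ffunE eqxx [_ *: _]mulr1 addr0.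
by rewrite !ffunE eq_sym (negPf nT) [LHS]mulr0.
Qed.

(* The subalgebra CL_m: coordinates on e_T vanish for odd #|T|. *)
Definition cleven : {pred clifford R m} :=
  [pred x : clifford R m |
    [forall T : {set 'I_m}, odd #|T| ==> (x T == 0)]].

Lemma clevenP x :
  reflect (forall T : {set 'I_m}, odd #|T| -> x T = 0) (x \in cleven).
Proof.
apply: (iffP forallP) => [x0 T oT|x0 T]; first exact: (eqP (implyP (x0 T) oT)).
by apply/implyP=> oT; rewrite x0.
Qed.

Lemma cleven_subalg : subalg_closed cleven.
Proof.
split=> [|a x y /clevenP x0 /clevenP y0|x y /clevenP x0 /clevenP y0].
- apply/clevenP=> T oT; rewrite ffunE; case: eqP => // T0.
  by rewrite T0 cards0 in oT.
- by apply/clevenP=> T oT; rewrite !ffunE x0 // y0 // [_ *: _]mulr0 addr0.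
apply/clevenP=> U oU; rewrite ffunE big1 // => S _.
have [oS|eS] := boolP (odd #|S|); first by rewrite x0 // mulr0 mul0r.
by rewrite y0 ?mulr0 // odd_card_symdiff oU addbT.
Qed.

HB.instance Definition _ :=
  GRing.isSubalgClosed.Build R (clifford R m) cleven cleven_subalg.
End Clifford.

Definition clnorm (R : rcfType) m (x : clifford R m) : R :=
  Num.sqrt (\sum_T (x T) ^+ 2).

Definition permanent (R : comNzRingType) n (A : 'M[R]_n) : R :=
  \sum_(s : 'S_n) \prod_i A i (s i).

(* [\det] is defined over noncommutative rings, with row-ordered products. *)
Definition Cdet (R : nzRingType) n (B : 'M[R]_n) : R := \det B.

Lemma CdetE (R : nzRingType) n (B : 'M[R]_n) :
  Cdet B = \sum_(s : 'S_n) (-1) ^+ s * \prod_i B i (s i).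
Proof. by []. Qed.

(* Algorithms are programs for a real RAM with unit cost. A program uses
   finitely many registers holding natural numbers, which serve as loop
   counters and as addresses, and finitely many arrays of real numbers.
   - The only operations on registers are constants, addition and truncated
     subtraction, so that the bit size of the registers grows by O(1) at
     each step.
   - The only constants of a program are natural and rational numbers.
   - The value of a real can only influence the registers through
     comparisons: there is no rounding, as unit-cost arithmetic combined with
     rounding would be unreasonably powerful. *)

(* [Cell a x] is the entry of array a whose address is in register x. *)
Record cell := Cell { cell_array : nat; cell_reg : nat }.

Inductive arith := Add | Sub | Mul | Div.

Inductive test :=
  | NatLt of nat & nat    (* comparison of two registers *)
  | RealLt of cell & cell.

(* The destination comes first. *)
Inductive instr :=
  | NatConst of nat & nat
  | NatAdd of nat & nat & nat
  | NatSub of nat & nat & nat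
  | RealConst of cell & rat
  | RealCopy of cell & cell
  | RealOp of arith & cell & cell & cell
  | If of test & seq instr & seq instr
  | While of test & seq instr.

Definition program := seq instr.

Definition update (V : Type) (f : nat -> V) (x : nat) (v : V) : nat -> V :=
  fun y => if y == x then v else f y.

Section RealRam.
Variable R : realType.

Record state := State { regs : nat -> nat; arrays : nat -> nat -> R }.

Definition get (s : state) (c : cell) : R :=
  arrays s (cell_array c) (regs s (cell_reg c)).

Definition set_reg (s : state) (x v : nat) : state :=
  State (update (regs s) x v) (arrays s).

Definition set_cell (s : state) (c : cell) (v : R) : state :=
  let a := cell_array c in
  State (regs s)
    (update (arrays s) a (update (arrays s a) (regs s (cell_reg c)) v)).

(* Division by 0 returns 0. *)
Definition eval_arith (o : arith) (u v : R) : R :=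
  match o with
  | Add => u + v
  | Sub => u - v
  | Mul => u * v
  | Div => u / v
  end.

Definition eval_test (s : state) (b : test) : bool :=
  match b with
  | NatLt x y => (regs s x < regs s y)%N
  | RealLt c d => get s c < get s d
  end.

(* A configuration consists of the instructions still to be executed and of
   the state; it is final when no instruction is left. *)
Definition step (c : program * state) : program * state :=
  let: (p, s) := c in
  if p isn't i :: q then c else
  match i with
  | NatConst x k => (q, set_reg s x k)
  | NatAdd x y z => (q, set_reg s x (regs s y + regs s z))
  | NatSub x y z => (q, set_reg s x (regs s y - regs s z))
  | RealConst d r => (q, set_cell s d (ratr r))
  | RealCopy d e => (q, set_cell s d (get s e))
  | RealOp o d e f => (q, set_cell s d (eval_arith o (get s e) (get s f)))
  | If b p1 p2 => ((if eval_test s b then p1 else p2) ++ q, s)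
  | While b p1 => ((if eval_test s b then p1 ++ p else q), s)
  end.

Definition halts_in (P : program) (s : state) (t : nat) (s' : state) : Prop :=
  iter t step (P, s) = ([::], s').

(* Initially register 0 contains n, array 0 contains the entries of A in
   row-major order, and everything else is 0. *)
Definition input_state n (A : 'M[R]_n) : state :=
  let entries := [seq A i j | i <- enum 'I_n, j <- enum 'I_n] in
  State (fun x => if x == 0%N then n else 0%N)
        (fun a k => if a == 0%N then nth 0 entries k else 0).

Definition subset_code m (T : {set 'I_m}) : nat := \sum_(i in T) 2 ^ i.

(* Array 1 contains the entries of B in row-major order, each of them being
   given by its 2 ^ m coordinates. *)
Definition outputs (s : state) m N (B : 'M[clifford R m]_N) : Prop :=
  forall (i j : 'I_N) (T : {set 'I_m}),
    arrays s 1 ((i * N + j) * 2 ^ m + subset_code T)%N = B i j T.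
End RealRam.

(* Main.v *)
(** The even products of five generators of [CL'_5] contain a copy of the
    real 2 x 2 matrices: with [g = e1 e2 e3 e4] and [u = e1 e2 e3 e5] we have
    [g^2 = u^2 = 1] and [g u = - u g], so that [p = (1 + g) / 2] is an idempotent
    with [u p = (1 - p) u]. Therefore [x_0 = p], [x_1 = p u], [y_0 = p],
    [y_1 = u p] satisfy [x_b y_c = p] if [b = c] and [0] otherwise. Even
    elements on disjoint sets of generators commute; multiplying over [l]
    blocks, one for each bit of an index [j < 2 ^ l], yields [x_j] and [y_j] with
    [x_i y_j = P] if [i = j] and [0] otherwise, where [P] is idempotent and
    [|P|^2 = 2 ^ (-l)].

    Let [B] have the entries [a_(i,j) x_j] in position [(2 i, 2 j)], [y_j] in
    position [(2 i + 1, 2 j + 1)], and [0] elsewhere. Reading the rows in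
    order, only the permutations that act in the same way on even and on odd
    indices contribute to the determinant. These are even, hence
    [Cdet B = perm A * P].

    The coordinates of all [x_j] and [y_j] form tables of polynomial size
    [n * 2 ^ m = n ^ 6], which are filled by doubling, one bit of [j] at a
    time. *)

Require Import Defs.
From mathcomp Require Import all_boot all_order all_fingroup all_algebra.
From mathcomp Require Import reals zify ring.
From Stdlib Require Import FunctionalExtensionality.

Set Implicit Arguments.
Unset Strict Implicit.
Unset Printing Implicit Defensive.

Import Order.TTheory GRing.Theory Num.Theory.
Local Open Scope ring_scope.

(** * Total correctness of programs *)

Section Ram.
Variable R : realType.
Implicit Types (s : state R) (P : program) (Q : state R -> Prop).

(* Quantifying over the continuation [q] makes runs composable. *)
Definition runs P (T : nat) s Q :=
  exists t s', [/\ (t <= T)%N,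
    forall q, iter t (@step R) (P ++ q, s) = (q, s') & Q s'].

Lemma runs_halts P T s Q :
  runs P T s Q -> exists t s', [/\ (t <= T)%N, halts_in P s t s' & Q s'].
Proof.
case=> t [s' [le_tT run_t Qs']]; exists t, s'; split=> //.
by rewrite /halts_in -{1}[P]cats0.
Qed.

Lemma runs_le P T T' s Q : (T <= T')%N -> runs P T s Q -> runs P T' s Q.
Proof.
move=> leT [t [s' [le_t run_t Qs']]]; exists t, s'; split=> //.
exact: leq_trans leT.
Qed.

Lemma runs_nil s Q : Q s -> runs [::] 0 s Q.
Proof. by exists 0%N, s. Qed.

Lemma runs_step i P T s s' Q :
  (forall q, step (i :: q, s) = (q, s')) -> runs P T s' Q ->
  runs (i :: P) T.+1 s Q.
Proof.
move=> step_i [t [s1 [le_t run_t Qs1]]]; exists t.+1, s1; split=> // q.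
by rewrite iterSr /= -/(step (i :: P ++ q, s)) step_i.
Qed.

(** The invariant is indexed by the number of iterations done, and the conditions on the test make
    this number exactly [N]. Each test costs one step, including the final one that fails. *)
Lemma runs_while (I : nat -> state R -> Prop) N b body P T T' s Q :
    (forall i s, (i < N)%N -> I i s ->
       eval_test s b /\ runs body T s (I i.+1)) ->
    (forall s, I N s -> ~~ eval_test s b) ->
    I 0%N s -> (forall s', I N s' -> runs P T' s' Q) ->
  runs (While b body :: P) (N * T.+1 + T'.+1) s Q.
Proof.
move=> I_body I_end I0 runP.
have loop k : (k <= N)%N -> exists t sk, [/\ (t <= k * T.+1)%N, I k sk &
    forall q, iter t (@step R) (While b body :: q, s) = (While b body :: q, sk)].
  elim: k => [_|k IHk lt_kN]; first by exists 0%N, s.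
  have [t [sk [le_t Ik run_t]]] := IHk (ltnW lt_kN).
  have [b_sk [t1 [s1 [le_t1 run_t1 Is1]]]] := I_body _ _ lt_kN Ik.
  exists (t1 + (1 + t))%N, s1; split=> // [|q].
    by rewrite mulSn addnA leq_add // addn1.
  by rewrite iterD iterD run_t /= b_sk run_t1.
have [t [sN [le_t IN run_t]]] := loop N (leqnn N).
have [t' [s' [le_t' run_t' Qs']]] := runP _ IN.
exists (t' + (1 + t))%N, s'; split=> // [|q].
  by rewrite addnCA addnA addnC leq_add // addnC.
by rewrite iterD iterD run_t /= (negPf (I_end _ IN)) run_t'.
Qed.

(** With finite lists, [/=] computes the effect of straight-line code on a state. *)
Definition mk (r : seq nat) (a : seq (nat -> R)) : state R :=
  State (nth 0%N r) (nth (fun=> 0) a).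

Lemma set_reg_mk r a x v : set_reg (mk r a) x v = mk (set_nth 0%N r x v) a.
Proof.
congr State; apply: functional_extensionality => y.
by rewrite nth_set_nth.
Qed.

Lemma set_cell_mk r a c v : set_cell (mk r a) c v =
  mk r (set_nth (fun=> 0) a (cell_array c)
    (update (nth (fun=> 0) a (cell_array c)) (nth 0%N r (cell_reg c)) v)).
Proof.
congr State; apply: functional_extensionality => y.
by rewrite nth_set_nth.
Qed.

Lemma runs_NatConst x k P T r a Q :
  runs P T (mk (set_nth 0%N r x k) a) Q ->
  runs (NatConst x k :: P) T.+1 (mk r a) Q.
Proof. by apply: runs_step => q /=; rewrite set_reg_mk. Qed.

Lemma runs_NatAdd x y z P T r a Q :
  runs P T (mk (set_nth 0%N r x (nth 0 r y + nth 0 r z)%N) a) Q ->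
  runs (NatAdd x y z :: P) T.+1 (mk r a) Q.
Proof. by apply: runs_step => q /=; rewrite set_reg_mk. Qed.

Lemma runs_NatSub x y z P T r a Q :
  runs P T (mk (set_nth 0%N r x (nth 0 r y - nth 0 r z)%N) a) Q ->
  runs (NatSub x y z :: P) T.+1 (mk r a) Q.
Proof. by apply: runs_step => q /=; rewrite set_reg_mk. Qed.

Definition set_array (a : seq (nat -> R)) i k v :=
  set_nth (fun=> 0) a i (update (nth (fun=> 0) a i) k v).

Lemma runs_RealConst i x c P T r a Q :
  runs P T (mk r (set_array a i (nth 0 r x)%N (ratr c))) Q ->
  runs (RealConst (Cell i x) c :: P) T.+1 (mk r a) Q.
Proof. by apply: runs_step => q /=; rewrite set_cell_mk. Qed.

Lemma runs_RealCopy i x j y P T r a Q :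
  runs P T (mk r (set_array a i (nth 0 r x)%N
    (nth (fun=> 0) a j (nth 0 r y)%N))) Q ->
  runs (RealCopy (Cell i x) (Cell j y) :: P) T.+1 (mk r a) Q.
Proof. by apply: runs_step => q /=; rewrite set_cell_mk. Qed.

Lemma runs_RealOp o i x j y k z P T r a Q :
  runs P T (mk r (set_array a i (nth 0 r x)%N
    (eval_arith o (nth (fun=> 0) a j (nth 0 r y)%N)
                  (nth (fun=> 0) a k (nth 0 r z)%N)))) Q ->
  runs (RealOp o (Cell i x) (Cell j y) (Cell k z) :: P) T.+1 (mk r a) Q.
Proof. by apply: runs_step => q /=; rewrite set_cell_mk. Qed.
End Ram.

(** * Tables of coordinates *)

Section Table.
Variable R : realType.
Implicit Types (eps : R) (X : nat -> R).

(* The coordinate on the subset with code [t] of [x_b] ([eps = 1]) or [y_b]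
   ([eps = -1]): with [g u = e4 e5] and [u g = - e4 e5], these are
   [(1 + e1 e2 e3 e4) / 2] for [b = 0] and [(e1 e2 e3 e5 + eps e4 e5) / 2] for
   [b = 1]; the subsets have the codes 0, 15, 23, 24. *)
Definition coef eps b t : R :=
  match b with
  | 0%N => ((t == 0%N) || (t == 15%N))%:R / 2
  | 1%N => ((t == 23%N)%:R + eps * (t == 24%N)%:R) / 2
  | _ => 0
  end.

(** The binary digits of [j] are paired with the base 32 digits of [T], one pair for each block. No
    sign enters, since the blocks are multiplied in increasing order. The leading quotients are not
    reduced, so that indices out of range give 0. *)
Fixpoint table eps k j T : R :=
  if k is k'.+1 then
    table eps k' (j %% 2 ^ k')%N (T %% 32 ^ k')%N
      * coef eps (j %/ 2 ^ k')%N (T %/ 32 ^ k')%N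
  else ((j == 0) && (T == 0))%N%:R.

(** The row [j] is unbounded, so the cells beyond level [k] are known to be 0. The next level relies
    on this, as it never writes the cells where [coef] vanishes. *)
Definition holds_table eps M k X :=
  forall j T, (T < M)%N -> X (j * M + T)%N = table eps k j T.

(* The state while passing from level [k] to level [k.+1]: cell [(j, T)] of
   the smaller table produces all cells congruent to it modulo
   [(2 ^ k, 32 ^ k)], and the cells before [(jc, Tc)] have been processed. *)
Definition holds_partial eps M k jc Tc X :=
  forall j T, (T < M)%N -> X (j * M + T)%N =
    if (j %% 2 ^ k < jc)%N || (j %% 2 ^ k == jc)%N && (T %% 32 ^ k < Tc)%N
    then table eps k.+1 j T else table eps k j T.

Lemma eq_addr M j j' T T' : (T < M)%N -> (T' < M)%N ->
  (j * M + T == j' * M + T')%N = (j == j') && (T == T').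
Proof.
move=> ltT ltT'; apply/eqP/andP => [E|[/eqP-> /eqP-> //]].
have M0 : (0 < M)%N by apply: leq_ltn_trans ltT.
have: ((j * M + T) %/ M = (j' * M + T') %/ M)%N by rewrite E.
rewrite !divnMDl // !divn_small // !addn0 => Ej.
by move: E; rewrite Ej => /addnI->.
Qed.

Lemma holds_partial_start eps M k X :
  holds_table eps M k X -> holds_partial eps M k 0 0 X.
Proof. by move=> hX j T ltT; rewrite ltn0 andbF hX. Qed.

Lemma holds_partial_next_row eps M k jc X :
  holds_partial eps M k jc (32 ^ k) X -> holds_partial eps M k jc.+1 0 X.
Proof.
move=> hX j T ltT; rewrite hX // ltn_mod expn_gt0 /= andbT ltn0 andbF orbF.
by rewrite ltnS [in RHS]leq_eqVlt orbC.
Qed.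

Lemma holds_partial_end eps M k X :
  holds_partial eps M k (2 ^ k) 0 X -> holds_table eps M k.+1 X.
Proof. by move=> hX j T ltT; rewrite hX // ltn_mod expn_gt0. Qed.

Lemma tableM eps k b j t T : (j < 2 ^ k)%N -> (T < 32 ^ k)%N ->
  table eps k.+1 (b * 2 ^ k + j)%N (t * 32 ^ k + T)%N =
    table eps k j T * coef eps b t.
Proof.
move=> ltj ltT /=.
rewrite !modnMDl !divnMDl ?expn_gt0 // (modn_small ltj) (modn_small ltT).
by rewrite (divn_small ltj) (divn_small ltT) !addn0.
Qed.

Lemma coef_out eps b t : ((2 <= b) || (32 <= t))%N -> coef eps b t = 0.
Proof.
case: b => [|[|b]] //= le_t.
  by rewrite !gtn_eqF ?mul0r //; lia.
by rewrite !gtn_eqF ?mulr0 ?addr0 ?mul0r //; lia.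
Qed.

Lemma table_out eps k j T :
  ((2 ^ k <= j) || (32 ^ k <= T))%N -> table eps k j T = 0.
Proof.
case: k => [|k] /=; first by case: j; case: T.
rewrite !expnS => out; rewrite coef_out ?mulr0 //.
by rewrite !leq_divRL ?expn_gt0.
Qed.

Lemma update_eq (V : Type) (f : nat -> V) x v : update f x v x = v.
Proof. by rewrite /update eqxx. Qed.

Lemma update_neq (V : Type) (f : nat -> V) x v y :
  y != x -> update f x v y = f y.
Proof. by rewrite /update => /negPf->. Qed.

(* The cell at [w] is halved in place, so the [X0 w] below is already halved. *)
Definition split_entry eps X w a1 a2 a3 :=
  let X0 := update X w (X w / 2) in
  let X1 := update X0 a1 (X0 w) in
  let X2 := update X1 a2 (X1 w) in
  update X2 a3 (eps * X2 w).

(** The codes 0, 15, 23, 24 are the only ones where [coef] can be nonzero; 0 and 15 belong to row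
    [jc], 23 and 24 to row [jc + N]. All other cells in the residue class of [(jc, Tc)] are 0 at
    both levels, and [M] is large enough for the shifted columns to stay in their row. *)
Lemma holds_partial_step eps M k jc Tc X (N := (2 ^ k)%N) (K := (32 ^ k)%N)
    (w := (jc * M + Tc)%N) :
    (32 ^ k.+1 <= M)%N -> (jc < N)%N -> (Tc < K)%N ->
    holds_partial eps M k jc Tc X ->
  holds_partial eps M k jc Tc.+1
    (split_entry eps X w (w + 15 * K)%N (w + (N * M + 23 * K))%N
      (w + (N * M + 24 * K))%N).
Proof.
move=> leM ltj ltT hX j T ltTM.
have N0 : (0 < N)%N by rewrite expn_gt0.
have K0 : (0 < K)%N by rewrite expn_gt0.
have leKM : (32 * K <= M)%N by rewrite -expnS.
have M0 : (0 < M)%N by lia.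
have Xw : X w = table eps k jc Tc.
  rewrite hX; last by lia.
  by rewrite !modn_small // eqxx !ltnn.
have def1 : (w + 15 * K = jc * M + (Tc + 15 * K))%N by rewrite /w; lia.
have def2 : (w + (N * M + 23 * K) = (jc + N) * M + (Tc + 23 * K))%N.
  by rewrite /w mulnDl; lia.
have def3 : (w + (N * M + 24 * K) = (jc + N) * M + (Tc + 24 * K))%N.
  by rewrite /w mulnDl; lia.
have ne1 : (w != w + 15 * K)%N by lia.
have ne2 : (w != w + (N * M + 23 * K))%N by nia.
rewrite /split_entry (update_neq _ _ ne2) (update_neq _ _ ne1) !update_eq.
rewrite /update def1 def2 def3 /w !eq_addr; try by lia.
rewrite -/w Xw hX // (divn_eq j N) (divn_eq T K) !modnMDl !modn_mod.
move: (j %/ N)%N (T %/ K)%N => b t.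
have ltjr : (j %% N < N)%N by rewrite ltn_mod.
have ltTr : (T %% K < K)%N by rewrite ltn_mod.
move: (j %% N)%N (T %% K)%N ltjr ltTr => jr Tr ltjr ltTr.
have [[-> ->]|ne] := eqVneq (jr, Tr) (jc, Tc).
  rewrite ltnSn !ltnn eqxx [_ || _]/=. rewrite (@tableM eps k b jc t Tc) //.
  have eqb u : (b * N + jc == jc + u * N)%N = (b == u).
    by rewrite addnC eqn_add2l eqn_pmul2r.
  have eqt u : (t * K + Tc == Tc + u * K)%N = (t == u).
    by rewrite addnC eqn_add2l eqn_pmul2r.
  have := eqb 0%N; rewrite mul0n addn0 => ->.
  have := eqb 1%N; rewrite mul1n => ->.
  have := eqt 0%N; rewrite mul0n addn0 => ->.
  rewrite !eqt /coef.
  case: b {eqb} => [|[|b]] /=.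
  - have [->|nt0] := eqVneq t 0%N.
      by rewrite /= ?(mul1r, mul0r, mulr1, mulr0, add0r) ?mulrCA.
    case: (t == 15)%N; rewrite /= ?(mul1r, mul0r, mulr0) // table_out //.
    by apply/orP; right; rewrite -/K; nia.
  - have [t24|_] := boolP (t == 24)%N.
      by rewrite (eqP t24) gtn_eqF // mulr1 add0r mulrCA.
    case: (t == 23)%N; rewrite /= ?mulr0 ?addr0 ?(mul0r, mul1r, mulr0) //.
    by rewrite table_out // -/N; apply/orP; left; nia.
  - by rewrite mulr0 table_out // -/N; apply/orP; left; nia.
(* A cell in another residue class is none of the four targets, and passing to [Tc.+1] does not
   change its status. *)
have neq_res b1 t1 b2 t2 : (b1 * N + jr == jc + b2 * N)%N &&
    (t1 * K + Tr == Tc + t2 * K)%N = false.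
  apply: contraNF ne; rewrite ![(jc + _)%N]addnC ![(Tc + _)%N]addnC.
  by rewrite !eq_addr // => /andP[/andP[_ /eqP->] /andP[_ /eqP->]].
have := neq_res b t 1 23; rewrite mul1n => ->.
have := neq_res b t 1 24; rewrite mul1n => ->.
have := neq_res b t 0 15; rewrite mul0n addn0 => ->.
have := neq_res b t 0 0; rewrite !mul0n !addn0 => ->.
congr (if _ || _ then _ else _).
apply: andb_id2l => /eqP Ej; rewrite ltnS [RHS]leq_eqVlt.
by move: ne; rewrite Ej xpair_eqE eqxx /= => /negPf->.
Qed.
End Table.

(** * The program *)

(* Arrays: 2 and 3 contain the tables of the [x_j] and of the [y_j], with rows
   of length [M = n ^ 5]; array 4 contains the constants 1/2 and 0.
   Registers: 0 is [n]; 1 is [M]; 2, 3, 4 are [2 ^ k], [32 ^ k], [2 ^ k * M] at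
   level [k]; 9 is 1 and 14 is 0; the others are loop counters and addresses. *)
Definition double_body : program :=
  [:: NatAdd 2 2 2; NatAdd 1 1 1; NatAdd 1 1 1; NatAdd 1 1 1; NatAdd 1 1 1;
      NatAdd 1 1 1].

(** Register 8 holds the source address, registers 10 to 12 the three offsets. Cell 1 of array 4 is
    0; subtracting from it yields the factor [eps = -1]. *)
Definition split_body : program :=
  [:: RealOp Mul (Cell 2 8) (Cell 2 8) (Cell 4 14);
      NatAdd 13 8 10; RealCopy (Cell 2 13) (Cell 2 8);
      NatAdd 13 8 11; RealCopy (Cell 2 13) (Cell 2 8);
      NatAdd 13 8 12; RealCopy (Cell 2 13) (Cell 2 8);
      RealOp Mul (Cell 3 8) (Cell 3 8) (Cell 4 14);
      NatAdd 13 8 10; RealCopy (Cell 3 13) (Cell 3 8);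
      NatAdd 13 8 11; RealCopy (Cell 3 13) (Cell 3 8);
      NatAdd 13 8 12; RealOp Defs.Sub (Cell 3 13) (Cell 4 9) (Cell 3 8);
      NatAdd 7 7 9; NatAdd 8 8 9].

Definition row_body : program :=
  [:: NatConst 7 0; NatAdd 8 6 14; While (NatLt 7 3) split_body;
      NatAdd 5 5 9; NatAdd 6 6 1].

(** The offsets are computed from [K = 32 ^ k] by additions and subtractions, as 15 = 16 - 1, 24 =
    16 + 8 and 23 = 24 - 1. The last two are shifted by [2 ^ k * M] to reach the row with the new
    bit set. *)
Definition level_body : program :=
  [:: NatAdd 13 3 3; NatAdd 13 13 13; NatAdd 13 13 13; NatAdd 12 13 13;
      NatSub 10 12 3; NatAdd 12 12 13; NatSub 11 12 3;
      NatAdd 11 4 11; NatAdd 12 4 12; NatConst 5 0; NatConst 6 0;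
      While (NatLt 5 2) row_body;
      NatAdd 2 2 2; NatAdd 4 4 4; NatAdd 3 3 3; NatAdd 3 3 3; NatAdd 3 3 3;
      NatAdd 3 3 3; NatAdd 3 3 3].

Definition copy_body : program :=
  [:: RealOp Mul (Cell 1 10) (Cell 0 12) (Cell 2 8);
      RealCopy (Cell 1 11) (Cell 3 8);
      NatAdd 7 7 9; NatAdd 8 8 9; NatAdd 10 10 9; NatAdd 11 11 9].

(** Registers 10 and 11 address the even-even and the odd-odd entries. The extra step by [M] skips
    the column of the other parity, and register 13 serves likewise for rows in [out_row_body].
    Entries of mixed parity keep their initial value 0. *)
Definition out_col_body : program :=
  [:: NatConst 7 0; While (NatLt 7 1) copy_body;
      NatAdd 10 10 1; NatAdd 11 11 1; NatAdd 12 12 9; NatAdd 6 6 9].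

Definition out_row_body : program :=
  [:: NatConst 6 0; NatConst 8 0; While (NatLt 6 0) out_col_body;
      NatAdd 10 10 13; NatAdd 11 11 13; NatAdd 5 5 9].

(** The exponent [l] is not given: register 2 is doubled until it reaches [n], while register 1 is
    multiplied by 32. *)
Definition size_part : program :=
  [:: NatConst 9 1; NatConst 1 1; NatConst 2 1; While (NatLt 2 0) double_body].

Definition table_part : program :=
  [:: NatConst 2 1; NatConst 3 1; NatAdd 4 1 14;
      RealConst (Cell 2 14) 1; RealConst (Cell 3 14) 1;
      RealConst (Cell 4 14) (1 / 2);
      While (NatLt 2 0) level_body].

Definition out_part : program :=
  [:: NatAdd 13 4 4; NatConst 10 0; NatAdd 11 13 1; NatConst 12 0; NatConst 5 0;
      While (NatLt 5 0) out_row_body].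

Definition perm_program : program := size_part ++ table_part ++ out_part.

Ltac straight := repeat (match goal with
  | |- runs (NatConst _ _ :: _) _ _ _ => apply: runs_NatConst
  | |- runs (NatAdd _ _ _ :: _) _ _ _ => apply: runs_NatAdd
  | |- runs (NatSub _ _ _ :: _) _ _ _ => apply: runs_NatSub
  | |- runs (RealConst _ _ :: _) _ _ _ => apply: runs_RealConst
  | |- runs (RealCopy _ _ :: _) _ _ _ => apply: runs_RealCopy
  | |- runs (RealOp _ _ _ _ :: _) _ _ _ => apply: runs_RealOp
  end; rewrite /set_array /=).

(** * Loop invariants and running time of the program *)

Section Correctness.
Variable R : realType.
Implicit Types (s : state R) (P : program) (Q : state R -> Prop).
Variables (l : nat) (A : nat -> R).
Let n := (2 ^ l)%N.
Let M := (32 ^ l)%N.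

Definition half_cell : nat -> R := update (fun=> 0) 0 (ratr (1 / 2)).

Definition tables k s r := exists X Y,
  [/\ s = mk r [:: A; fun=> 0; X; Y; half_cell],
      holds_table 1 M k X & holds_table (-1) M k Y].

Definition partial_tables k jc Tc s r := exists X Y,
  [/\ s = mk r [:: A; fun=> 0; X; Y; half_cell],
      holds_partial 1 M k jc Tc X & holds_partial (-1) M k jc Tc Y].

Definition split_regs k j c T w g : seq nat :=
  [:: n; M; 2 ^ k; 32 ^ k; 2 ^ k * M; j; c; T; w; 1; 15 * 32 ^ k;
      2 ^ k * M + 23 * 32 ^ k; 2 ^ k * M + 24 * 32 ^ k; g; 0]%N.

Lemma runs_split_body k j T s g :
  (k < l)%N -> (j < 2 ^ k)%N -> (T < 32 ^ k)%N ->
  partial_tables k j T s (split_regs k j (j * M) T (j * M + T) g) ->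
  runs split_body 16 s (fun s' => exists g,
    partial_tables k j T.+1 s' (split_regs k j (j * M) T.+1 (j * M + T.+1) g)).
Proof.
move=> ltkl ltj ltT [X [Y [-> hX hY]]]; rewrite /split_body; straight.
apply: runs_nil.
have leM : (32 ^ k.+1 <= M)%N by rewrite leq_exp2l.
have hX' := holds_partial_step leM ltj ltT hX.
have hY' := holds_partial_step leM ltj ltT hY.
have half : half_cell 0 = 2^-1.
  by rewrite /half_cell update_eq fmorph_div rmorph1 rmorph_nat mul1r.
have zero : half_cell 1 = 0 by rewrite /half_cell update_neq.
exists (j * M + T + (2 ^ k * M + 24 * 32 ^ k))%N.
exists (split_entry 1 X (j * M + T) (j * M + T + 15 * 32 ^ k)
  (j * M + T + (2 ^ k * M + 23 * 32 ^ k))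
  (j * M + T + (2 ^ k * M + 24 * 32 ^ k)))%N.
exists (split_entry (-1) Y (j * M + T) (j * M + T + 15 * 32 ^ k)
  (j * M + T + (2 ^ k * M + 23 * 32 ^ k))
  (j * M + T + (2 ^ k * M + 24 * 32 ^ k)))%N.
split; [|exact: hX'|exact: hY'].
rewrite /split_entry /= zero half mul1r mulN1r sub0r /split_regs.
by rewrite !addn1 !addnS.
Qed.

Lemma runs_row_body k j s r : (k < l)%N -> (j < 2 ^ k)%N ->
  (exists T w g, r = split_regs k j (j * M) T w g) ->
  partial_tables k j 0 s r ->
  runs row_body (22 * 32 ^ k) s (fun s' => exists T w g,
    partial_tables k j.+1 0 s' (split_regs k j.+1 (j.+1 * M) T w g)).
Proof.
move=> ltkl ltj [T0 [w0 [g0 ->]]] [X [Y [-> hX hY]]].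
apply: (@runs_le _ _ (2 + (32 ^ k * 17 + 3))).
  by have : (0 < 32 ^ k)%N by [rewrite expn_gt0]; lia.
rewrite /row_body; straight.
apply: (@runs_while _ (fun T s => exists g,
   partial_tables k j T s (split_regs k j (j * M) T (j * M + T) g))%N).
- move=> T s' ltT hs; split; last first.
    by case: hs => g /(runs_split_body ltkl ltj ltT).
  by case: hs => [g [X' [Y' [-> _ _]]]].
- by move=> s' [g [X' [Y' [-> _ _]]]]; rewrite /= ltnn.
- by exists g0, X, Y; rewrite /split_regs !addn0.
move=> s' [g [X' [Y' [-> hX' hY']]]]; straight.
apply: runs_nil; exists (32 ^ k)%N, (j * M + 32 ^ k)%N, g, X', Y'.
split; try exact: holds_partial_next_row.
by rewrite /split_regs addn1 -mulSnr.
Qed.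

Definition level_regs k rest : seq nat :=
  [:: n; M; 2 ^ k; 32 ^ k; 2 ^ k * M]%N ++ rest.
Definition tail_regs (a b c d e f g h : nat) : seq nat :=
  [:: a; b; c; d; 1; e; f; g; h; 0]%N.

Lemma runs_level_body k s : (k < l)%N ->
  (exists a b c d e f g h,
     tables k s (level_regs k (tail_regs a b c d e f g h))) ->
  runs level_body (44 * (n * M)) s (fun s' => exists a b c d e f g h,
     tables k.+1 s' (level_regs k.+1 (tail_regs a b c d e f g h))).
Proof.
move=> ltkl [a [b [c [d [e [f [g [h [X [Y [-> hX hY]]]]]]]]]]].
apply: (@runs_le _ _ (11 + (2 ^ k * (22 * 32 ^ k).+1 + 8))).
  have ltn : (2 ^ k < n)%N by rewrite ltn_exp2l.
  have ltM : (32 ^ k < M)%N by rewrite ltn_exp2l.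
  have n0 : (0 < 2 ^ k)%N by rewrite expn_gt0.
  have M0 : (0 < 32 ^ k)%N by rewrite expn_gt0.
  by nia.
rewrite /level_body; straight.
apply: (@runs_while _ (fun j s => exists T w g,
   partial_tables k j 0 s (split_regs k j (j * M) T w g))%N).
- move=> j s' ltj hs; split.
    by case: hs => [T [w [g' [X' [Y' [-> _ _]]]]]].
  case: hs => [T [w [g' hs]]]; apply: runs_row_body ltkl ltj _ hs.
  by exists T, w, g'.
- by move=> s' [T [w [g' [X' [Y' [-> _ _]]]]]]; rewrite /= ltnn.
- exists c, d; eexists; exists X, Y; split; try exact: holds_partial_start.
  rewrite /split_regs mul0n.
  congr (mk [:: _; _; _; _; _; _; _; _; _; _; _; _; _; _; _] _); first lia.
    by lia.
  by lia.
move=> s' [T [w [g' [X' [Y' [-> hX' hY']]]]]].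
straight; apply: runs_nil; do 8 eexists; exists X', Y'.
split; try exact: holds_partial_end.
rewrite /level_regs /tail_regs /split_regs /=.
congr (mk [:: _; _; _; _; _; _; _; _; _; _; _; _; _; _; _] _).
- by rewrite expnS; lia.
- by rewrite expnS; lia.
- by rewrite expnS; lia.
Qed.

Definition zero_array : nat -> R := fun=> 0.
Definition input_arrays := [:: A; zero_array; zero_array; zero_array; zero_array].

Definition size_regs k : seq nat :=
  [:: n; 32 ^ k; 2 ^ k; 0; 0; 0; 0; 0; 0; 1; 0; 0; 0; 0; 0]%N.

Lemma runs_size_part P T Q :
  runs P T (mk (size_regs l)
              input_arrays) Q ->
  runs (size_part ++ P) (3 + (l * 7 + T.+1))
    (mk (n :: nseq 14 0)%N input_arrays) Q.
Proof.
move=> runP; rewrite /size_part /=; straight.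
apply: (@runs_while _ (fun k s => s =
   mk (size_regs k)
      input_arrays)).
- move=> k s ltkl ->; split; first by rewrite /= ltn_exp2l.
  rewrite /double_body; straight; apply: runs_nil.
  by congr (mk [:: _; _; _; _; _; _; _; _; _; _; _; _; _; _; _] _);
    rewrite expnS; lia.
- by move=> s ->; rewrite /= ltnn.
- by [].
by move=> s ->.
Qed.

Lemma holds_table0 (eps : R) : @holds_table R eps M 0 (update (fun=> 0) 0 1).
Proof.
have M0 : (0 < M)%N by rewrite expn_gt0.
move=> j T ltT; rewrite /update -[X in _ == X]/(0 * M + 0)%N eq_addr //=.
by case: (_ && _).
Qed.

Lemma runs_table_part P T Q :
  (forall s, (exists a b c d e f g h,
     tables l s (level_regs l (tail_regs a b c d e f g h))) -> runs P T s Q) ->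
  runs (table_part ++ P) (6 + (l * (44 * (n * M)).+1 + T.+1))
    (mk (size_regs l)
        input_arrays) Q.
Proof.
move=> runP; rewrite /table_part /=; straight.
apply: (@runs_while _ (fun k s => exists a b c d e f g h,
   tables k s (level_regs k (tail_regs a b c d e f g h)))).
- move=> k s ltkl hs; split; last exact: runs_level_body.
  case: hs => [a [b [c [d [e [f [g [h [X [Y [-> _ _]]]]]]]]]]].
  by rewrite /= ltn_exp2l.
- by move=> s [a [b [c [d [e [f [g [h [X [Y [-> _ _]]]]]]]]]]]; rewrite /= ltnn.
- do 8 eexists; do 2 eexists; split; try exact: holds_table0.
  rewrite /level_regs /tail_regs rmorph1 /= !expn0 mul1n addn0.
  by congr mk.
by [].
Qed.

Definition out_entry I J T : R :=
  if odd I != odd J then 0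
  else if odd I then table (-1) l J./2 T
  else A (I./2 * n + J./2)%N * table 1 l J./2 T.

(* The program writes the entries for [(i, j, T)] in lexicographic order; [c]
   counts those already written. *)
Definition holds_out c (O : nat -> R) := forall I J T,
  (I < 2 * n)%N -> (J < 2 * n)%N -> (T < M)%N ->
  O ((I * (2 * n) + J) * M + T)%N =
    if ((I./2 * n + J./2) * M + T < c)%N then out_entry I J T else 0.

(** The counter depends only on the halves of the indices, so one increment accounts for both the
    even-even and the odd-odd cell; cells of mixed parity are 0 before and after. *)
Lemma holds_out_step i j T O X Y :
  (i < n)%N -> (j < n)%N -> (T < M)%N ->
  holds_table 1 M l X -> holds_table (-1) M l Y ->
  holds_out ((i * n + j) * M + T)%N O ->
  holds_out ((i * n + j) * M + T).+1 (update
    (update O ((i.*2 * (2 * n) + j.*2) * M + T)%N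
       (A (i * n + j)%N * X (j * M + T)%N))
    ((i.*2.+1 * (2 * n) + j.*2.+1) * M + T)%N (Y (j * M + T)%N)).
Proof.
move=> lti ltj ltT hX hY hO I J T' ltI ltJ ltT'.
rewrite hX // hY // /update !eq_addr //; try lia.
rewrite hO // ltnS [X in _ = if X then _ else _]leq_eqVlt !eq_addr //; try lia.
have eq_odd a b : (a == b.*2.+1)%N = odd a && (a./2 == b) by lia.
have eq_even a b : (a == b.*2)%N = ~~ odd a && (a./2 == b) by lia.
rewrite !eq_odd !eq_even /out_entry.
have [->|_] := eqVneq I./2 i; last by rewrite !andbF.
have [->|_] := eqVneq J./2 j; last by rewrite !andbF.
have [->|_] := eqVneq T' T; last by rewrite !andbF.
by rewrite ltnn; case: (odd I); case: (odd J).
Qed.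

Definition out_state c s r := exists O X Y,
  [/\ s = mk r [:: A; O; X; Y; half_cell], holds_table 1 M l X,
      holds_table (-1) M l Y & holds_out c O].

Definition copy_regs i j T : seq nat :=
  [:: n; M; n; M; n * M; i; j; T; j * M + T; 1;
      (i.*2 * (2 * n) + j.*2) * M + T;
      (i.*2.+1 * (2 * n) + j.*2.+1) * M + T;
      i * n + j; 2 * n * M; 0]%N.

Lemma runs_copy_body i j T s : (i < n)%N -> (j < n)%N -> (T < M)%N ->
  out_state ((i * n + j) * M + T) s (copy_regs i j T) ->
  runs copy_body 6 s
    (fun s' => out_state ((i * n + j) * M + T.+1) s' (copy_regs i j T.+1)).
Proof.
move=> lti ltj ltT [O [X [Y [-> hX hY hO]]]]; rewrite /copy_body; straight.
apply: runs_nil; have := holds_out_step lti ltj ltT hX hY hO; rewrite -addnS.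
move=> hO'; eexists; exists X, Y; split; try exact: hO'; rewrite //.
by rewrite /copy_regs !addn1 !addnS.
Qed.

Definition col_regs i j T w : seq nat :=
  [:: n; M; n; M; n * M; i; j; T; w; 1;
      (i.*2 * (2 * n) + j.*2) * M; (i.*2.+1 * (2 * n) + j.*2.+1) * M;
      i * n + j; 2 * n * M; 0]%N.

Lemma runs_out_col_body i j s : (i < n)%N -> (j < n)%N ->
  (exists T, out_state ((i * n + j) * M) s (col_regs i j T (j * M))) ->
  runs out_col_body (13 * M) s
    (fun s' => exists T,
       out_state ((i * n + j.+1) * M) s' (col_regs i j.+1 T (j.+1 * M))).
Proof.
move=> lti ltj [T0 [O [X [Y [-> hX hY hO]]]]].
apply: (@runs_le _ _ (1 + (M * 7 + 5))).
  by have : (0 < M)%N by [rewrite expn_gt0]; lia.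
rewrite /out_col_body; straight.
apply: (@runs_while _ (fun T s =>
  out_state ((i * n + j) * M + T) s (copy_regs i j T))).
- move=> T s' ltT hs; split; last exact: runs_copy_body.
  by case: hs => [O' [X' [Y' [-> _ _ _]]]].
- by move=> s' [O' [X' [Y' [-> _ _ _]]]]; rewrite /= ltnn.
- exists O, X, Y; split=> //; last by rewrite addn0.
  by rewrite /copy_regs !addn0.
move=> s' [O' [X' [Y' [-> hX' hY' hO']]]].
straight; apply: runs_nil; exists M, O', X', Y'; split=> //; last first.
  by rewrite addnS mulSnr.
rewrite /col_regs addn1 addn1 addnS -!mulSnr.
by congr (mk [:: _; _; _; _; _; _; _; _; _; _; _; _; _; _; _] _);
  rewrite ?doubleS; lia.
Qed.

Definition out_row_regs i j T w : seq nat :=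
  [:: n; M; n; M; n * M; i; j; T; w; 1;
      i.*2 * (2 * n) * M; (i.*2.+1 * (2 * n) + 1) * M; i * n; 2 * n * M; 0]%N.

Lemma runs_out_row_body i s : (i < n)%N ->
  (exists j T w, out_state (i * n * M) s (out_row_regs i j T w)) ->
  runs out_row_body (20 * (n * M)) s
    (fun s' => exists j T w,
       out_state (i.+1 * n * M) s' (out_row_regs i.+1 j T w)).
Proof.
move=> lti [j0 [T0 [w0 [O [X [Y [-> hX hY hO]]]]]]].
apply: (@runs_le _ _ (2 + (n * (13 * M).+1 + 4))).
  have M0 : (0 < M)%N by rewrite expn_gt0.
  have n0 : (0 < n)%N by rewrite expn_gt0.
  by nia.
rewrite /out_row_body; straight.
apply: (@runs_while _ (fun j s => exists T,
   out_state ((i * n + j) * M) s (col_regs i j T (j * M)))%N).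
- move=> j s' ltj hs; split; last exact: runs_out_col_body.
  by case: hs => [T [O' [X' [Y' [-> _ _ _]]]]].
- by move=> s' [T [O' [X' [Y' [-> _ _ _]]]]]; rewrite /= ltnn.
- exists T0, O, X, Y; split=> //; last by rewrite addn0.
  by rewrite /col_regs !addn0 mul0n.
move=> s' [T [O' [X' [Y' [-> hX' hY' hO']]]]].
straight; apply: runs_nil; exists n, T, (n * M)%N, O', X', Y'.
split=> //; last by rewrite mulSnr.
rewrite /col_regs addn1 mulSnr.
by congr (mk [:: _; _; _; _; _; _; _; _; _; _; _; _; _; _; _] _);
  rewrite ?doubleS; lia.
Qed.

Lemma runs_out_part s :
  (exists a b c d e f g h,
     tables l s (level_regs l (tail_regs a b c d e f g h))) ->
  runs out_part (27 * (n * n * M)) s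
    (fun s' => exists r, out_state (n * n * M) s' r).
Proof.
move=> [a [b [c [d [e [f [g [h [X [Y [-> hX hY]]]]]]]]]]].
apply: (@runs_le _ _ (5 + (n * (20 * (n * M)).+1 + 1))).
  have M0 : (0 < M)%N by rewrite expn_gt0.
  have n0 : (0 < n)%N by rewrite expn_gt0.
  by nia.
rewrite /out_part; straight.
apply: (@runs_while _ (fun i s => exists j T w,
  out_state (i * n * M) s (out_row_regs i j T w))).
- move=> i s' lti hs; split; last exact: runs_out_row_body.
  by case: hs => [j [T [w [O' [X' [Y' [-> _ _ _]]]]]]].
- by move=> s' [j [T [w [O' [X' [Y' [-> _ _ _]]]]]]]; rewrite /= ltnn.
- do 3 eexists; exists (fun=> 0), X, Y; split=> //.
  rewrite /level_regs /tail_regs /=.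
  by congr (mk [:: _; _; _; _; _; _; _; _; _; _; _; _; _; _; _] _); lia.
move=> s' [j [T [w hs]]]; apply: runs_nil; eexists; exact: hs.
Qed.

(** The tables take [l] levels of order [n * M] and the output takes order [n * n * M]; now [l < n]
    and [M = n ^ 5]. *)
Lemma runs_perm_program :
  runs perm_program (100 * n ^ 7)
    (mk (n :: nseq 14 0)%N input_arrays)
    (fun s' => exists r, out_state (n * n * M) s' r).
Proof.
apply: (@runs_le _ _ (3 + (l * 7 +
    (6 + (l * (44 * (n * M)).+1 + (27 * (n * n * M)).+1)).+1))).
  have M0 : (0 < M)%N by rewrite expn_gt0.
  have n0 : (0 < n)%N by rewrite expn_gt0.
  have ltln : (l < n)%N by rewrite ltn_expl.
  have -> : (n ^ 7 = n * n * M)%N.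
    have -> : M = (n ^ 5)%N by rewrite /M /n -expnM mulnC expnM.
    by rewrite -mulnA -!expnS.
  by nia.
apply: runs_size_part; apply: runs_table_part => s; exact: runs_out_part.
Qed.
End Correctness.

(** * Determinants of doubled matrices *)

Section Doubling.
Variable n : nat.

Fact dbl_subproof (b : bool) (i : 'I_n) : (i.*2 + b < 2 * n)%N.
Proof. by case: i => i /= lti; case: b; lia. Qed.
Definition dbl b i := Ordinal (dbl_subproof b i).

Fact ord_half_subproof (k : 'I_(2 * n)) : (k./2 < n)%N.
Proof. by case: k => k /=; lia. Qed.
Definition ord_half k := Ordinal (ord_half_subproof k).

Lemma dblK b : cancel (dbl b) ord_half.
Proof. by move=> i; apply: val_inj => /=; case: b; lia. Qed.

Lemma odd_dbl b i : odd (dbl b i) = b.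
Proof. by case: b => /=; lia. Qed.

Lemma ord_halfK (k : 'I_(2 * n)) : dbl (odd k) (ord_half k) = k.
Proof. by apply: val_inj; rewrite /= addnC odd_double_half. Qed.

Lemma dbl_inj b : injective (dbl b).
Proof. exact: can_inj (dblK b). Qed.

Lemma dbl_eq b c i j : (dbl b i == dbl c j) = (b == c) && (i == j).
Proof.
apply/eqP/andP => [E|[/eqP-> /eqP-> //]].
have -> : b = c by rewrite -(odd_dbl b i) E odd_dbl.
have -> : i = j by rewrite -(dblK b i) E dblK.
by rewrite !eqxx.
Qed.

Lemma prod_dbl (C : nzRingType) (F : 'I_(2 * n) -> C) :
  \prod_i F i = \prod_i (F (dbl false i) * F (dbl true i)).
Proof.
(* Extending [F] to all naturals, with default 1, allows consecutive factors to be paired without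
   changing their order. *)
pose G k := oapp F 1 (insub k).
have GE i : F i = G i by rewrite /G valK.
rewrite (eq_bigr _ (fun i _ => GE i)) -(big_mkord xpredT G) mulnC big_nat_mul.
rewrite big_mkord; apply: eq_bigr => i _; rewrite !GE /=.
have lt0 : (i * 2 < i.+1 * 2)%N by lia.
have lt1 : ((i * 2).+1 < i.+1 * 2)%N by lia.
rewrite (big_ltn lt0) (big_ltn lt1) big_geq ?mulr1; last by lia.
by rewrite addn0 addn1 muln2.
Qed.

Implicit Types s t : 'S_n.

Fact dbl_perm_subproof s :
  injective (fun k : 'I_(2 * n) => dbl (odd k) (s (ord_half k))).
Proof.
move=> k k' /eqP; rewrite dbl_eq (inj_eq perm_inj) => /andP[/eqP Eo /eqP Eh].
by rewrite -(ord_halfK k) -(ord_halfK k') Eo Eh.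
Qed.
Definition dbl_perm s : 'S_(2 * n) := perm (@dbl_perm_subproof s).

Lemma dbl_permE s b i : dbl_perm s (dbl b i) = dbl b (s i).
Proof. by rewrite permE odd_dbl dblK. Qed.

Lemma dbl_perm_inj : injective dbl_perm.
Proof.
move=> s t E; apply/permP => i; apply: (@dbl_inj false).
by rewrite -!dbl_permE E.
Qed.

Lemma dbl_permM s t : dbl_perm (s * t)%g = (dbl_perm s * dbl_perm t)%g.
Proof. by apply/permP => k; rewrite -(ord_halfK k) permM !dbl_permE permM. Qed.

Lemma dbl_perm_tperm i j : dbl_perm (tperm i j) =
  (tperm (dbl false i) (dbl false j) * tperm (dbl true i) (dbl true j))%g.
Proof.
apply/permP => k; rewrite -(ord_halfK k) permM dbl_permE.
case: (odd k).
  rewrite (inj_tperm _ _ _ (@dbl_inj true)).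
  by rewrite [tperm (dbl false _) _ _]tpermD ?dbl_eq.
by rewrite -(inj_tperm _ _ _ (@dbl_inj false)) [RHS]tpermD ?dbl_eq.
Qed.

(** A permutation is a product of transpositions, and doubling turns each of them into two. *)
Lemma odd_dbl_perm s : odd_perm (dbl_perm s) = false.
Proof.
have [ts -> _] := prod_tpermP s; elim: ts => [|t ts IHts].
  rewrite big_nil (_ : dbl_perm 1 = 1%g) ?odd_perm1 //.
  by apply/permP => k; rewrite -(ord_halfK k) dbl_permE !perm1.
by rewrite big_cons dbl_permM odd_permM IHts dbl_perm_tperm odd_permM
  !odd_tperm !dbl_eq !eqxx addbF addbb.
Qed.
End Doubling.

Lemma prod_eq0_noncomm (C : nzRingType) (I : finType) (F : I -> C) (i : I) :
  F i = 0 -> \prod_j F j = 0.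
Proof.
move=> Fi0; have := mem_index_enum i; elim: (index_enum I) => //= j r IHr.
rewrite inE big_cons => /orP[/eqP<-|/IHr->]; last by rewrite mulr0.
by rewrite Fi0 mul0r.
Qed.

(** * Row-ordered determinant of the doubled matrix *)

Section DoubledDeterminant.
Variables (R : comNzRingType) (C : algType R) (n : nat) (A : 'M[R]_n).
Variables (x y : 'I_n -> C) (p : C).
Hypotheses (n_gt0 : (0 < n)%N) (pp : p * p = p).
Hypothesis xy : forall i j, x i * y j = if i == j then p else 0.

Definition dbl_mx : 'M[C]_(2 * n) := \matrix_(i, j)
  if odd i != odd j then 0
  else if odd i then y (ord_half j)
  else A (ord_half i) (ord_half j) *: x (ord_half j).

Lemma dbl_mx_dbl b c i j : dbl_mx (dbl b i) (dbl c j) =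
  if b != c then 0 else if b then y j else A i j *: x j.
Proof. by rewrite mxE !odd_dbl !dblK. Qed.

Lemma Cdet_dbl_mx : Cdet dbl_mx = permanent A *: p.
Proof.
(* Each of the [n] pairs of rows contributes a factor [p]; as [n > 0], these collapse to one. *)
have pX : p ^+ n = p.
  by case: n n_gt0 => // k _; elim: k => [|k IHk]; rewrite ?expr1 // exprS IHk.
have prod_p (F : 'I_n -> R) : \prod_i (F i *: p) = (\prod_i F i) *: p.
  by rewrite scaler_prod prodr_const card_ord pX.
rewrite CdetE (bigID (mem [set dbl_perm s | s : 'S_n])) /= addrC big1 => [|s ns].
  rewrite add0r big_imset /=; last by move=> s t _ _; apply: dbl_perm_inj.
  rewrite scaler_suml; apply: eq_big => [s|s _]; first by rewrite inE.
  rewrite odd_dbl_perm mul1r prod_dbl -prod_p; apply: eq_bigr => i _.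
  by rewrite !dbl_permE !dbl_mx_dbl -scalerAl xy eqxx.
(* Either every pair of rows goes to some columns [2 j], [2 j + 1] in this order, and then [s]
   doubles the permutation of the halves, contrary to [ns]; or a single bad pair of rows already has
   product 0. *)
have [good|] := boolP [forall i,
    (s (dbl true i) == dbl true (ord_half (s (dbl false i))))
    && ~~ odd (s (dbl false i))].
  have {}good i : s (dbl true i) = dbl true (ord_half (s (dbl false i))) /\
      s (dbl false i) = dbl false (ord_half (s (dbl false i))).
    have /andP[/eqP-> even_s] := forallP good i; split=> //.
    by rewrite -[LHS]ord_halfK (negPf even_s).
  have f_inj : injective (fun i => ord_half (s (dbl false i))).
    move=> i j E; apply: (@dbl_inj n false); apply: (@perm_inj _ s).
    by have [_ ->] := good i; have [_ ->] := good j; rewrite E.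
  case/imsetP: ns; exists (perm f_inj) => //; apply/permP => k.
  rewrite -(ord_halfK k) dbl_permE permE.
  by case: (odd k); have [E0 E1] := good (ord_half k).
rewrite negb_forall => /existsP[i bad].
rewrite prod_dbl (prod_eq0_noncomm (i := i)) ?mulr0 //.
have := dbl_mx_dbl false (odd (s (dbl false i))) i (ord_half (s (dbl false i))).
have := dbl_mx_dbl true (odd (s (dbl true i))) i (ord_half (s (dbl true i))).
rewrite !ord_halfK => -> ->; move: bad.
have := ord_halfK (s (dbl true i)).
case: (odd (s (dbl false i))); first by rewrite mul0r.
case: (odd (s (dbl true i))) => [<-|_ _]; last by rewrite mulr0.
rewrite dbl_eq dblK andbT /= eq_sym => /negPf ne.
by rewrite -scalerAl xy ne scaler0.
Qed.
End DoubledDeterminant.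

(** * Subset codes and products of basis elements *)

Section SubsetCode.
Variable m : nat.
Implicit Types (S T U : {set 'I_m}).

Definition low d U : {set 'I_m} := [set i in U | (i < d)%N].
Definition high d U : {set 'I_m} := [set i in U | (d <= i)%N].

Lemma subset_code_low_high d U :
  subset_code U = (subset_code (low d U) + subset_code (high d U))%N.
Proof.
rewrite /subset_code (bigID (fun i : 'I_m => (i < d)%N)) /=.
congr (_ + _)%N; apply: eq_bigl => i; rewrite inE //.
by rewrite -leqNgt.
Qed.

Lemma subset_code_low_lt d U : (subset_code (low d U) < 2 ^ d)%N.
Proof.
elim: d => [|d IHd].
  by rewrite /subset_code big_pred0 // => i; rewrite inE ltn0 andbF.
rewrite (subset_code_low_high d) expnS mul2n -addnn -addSn.
have -> : low d (low d.+1 U) = low d U.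
  apply/setP => i; rewrite !inE -andbA; congr (_ && _).
  by apply/andP/idP => [[] //|lt_id]; rewrite ltnW.
rewrite leq_add //.
rewrite /subset_code; have [lt_dm|le_md] := ltnP d m; last first.
  rewrite big_pred0 ?expn_gt0 // => i; rewrite !inE. rewrite [(d <= i)%N]leqNgt.
  by rewrite (leq_trans (ltn_ord i) le_md) andbF.
rewrite (bigID (pred1 (Ordinal lt_dm))) /= [X in (_ + X)%N]big1 ?addn0 => [|i].
  rewrite big_mkcondl /= big_pred1_eq.
  by case: ifP.
rewrite !inE -val_eqE /= => /andP[/andP[/andP[_ lti] lei]] /negP[].
by rewrite eqn_leq lei -ltnS lti.
Qed.

Lemma dvdn_subset_code_high d U : (2 ^ d %| subset_code (high d U))%N.
Proof.
apply: dvdn_sum => i; rewrite inE => /andP[_ le_di]; exact: dvdn_exp2l.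
Qed.

Lemma subset_code_mod d U : (subset_code U %% 2 ^ d)%N = subset_code (low d U).
Proof.
rewrite (subset_code_low_high d U) -modnDmr.
by rewrite (eqP (dvdn_subset_code_high d U)) addn0 modn_small //
  subset_code_low_lt.
Qed.

Lemma subset_code_high d U :
  subset_code (high d U) = (subset_code U %/ 2 ^ d * 2 ^ d)%N.
Proof.
apply/eqP; rewrite -(eqn_add2l (subset_code (low d U))).
by rewrite -subset_code_low_high -subset_code_mod addnC -divn_eq.
Qed.

Lemma subset_code_inj : injective (@subset_code m).
Proof.
move=> U V E; apply/setP => i.
have lowS W : subset_code (low i.+1 W) =
    (subset_code (low i W) + (i \in W) * 2 ^ i)%N.
  rewrite (subset_code_low_high i); congr (_ + _)%N.
    congr subset_code; apply/setP => j; rewrite !inE -andbA; congr (_ && _).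
    by apply/andP/idP => [[] //|lt_ij]; rewrite ltnW.
  rewrite /subset_code (bigID (pred1 i)) /= [X in (_ + X)%N]big1 ?addn0 => [|j].
    rewrite big_mkcondl /= big_pred1_eq !inE ltnSn leqnn !andbT.
    by case: (i \in W); rewrite ?mul1n.
  rewrite !inE -val_eqE /= => /andP[/andP[/andP[_ ltj] lej]] /negP[].
  by rewrite eqn_leq lej -ltnS ltj.
(* Cancelling the common residue modulo [2 ^ i] leaves the bit [i] of each code. *)
have := congr1 (fun c => c %% 2 ^ i.+1)%N E; rewrite /= !subset_code_mod !lowS.
rewrite -!subset_code_mod E => /addnI/eqP; rewrite eqn_pmul2r ?expn_gt0 //.
by case: (i \in U); case: (i \in V).
Qed.
End SubsetCode.

(** * Right multiplication by generators of higher index *)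

Section LowHighProduct.
Variables (R : comNzRingType) (m : nat).
Implicit Types (S T U : {set 'I_m}) (x y : clifford R m).

Lemma csign_lt S T :
  (forall i j, i \in S -> j \in T -> (i < j)%N) -> csign R S T = 1.
Proof.
move=> ltST; rewrite /csign /inversions (_ : inversion_set _ _ = set0) ?cards0 //.
apply/setP => -[i j]; rewrite !inE /=; apply/and3P => -[/ltST lt_i /lt_i].
by move=> lt_ij; rewrite ltnNge ltnW.
Qed.

Definition supported d x := forall T, high d T != set0 -> x T = 0.

Lemma clmul_clbasis d x S U : supported d x -> low d S = set0 ->
  (x * clbasis R S) U = x (symdiff U S).
Proof.
move=> x_low S_high; rewrite ffunE (bigD1 (symdiff U S)) //= big1 => [|V nV].
  rewrite addr0 ffunE (symdiffC U S) -symdiffA symdiffss symdiffs0 eqxx mulr1.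
  rewrite symdiffC; have [high0|nhigh] := eqVneq (high d (symdiff U S)) set0.
    rewrite csign_lt ?mul1r // => i j iV jS.
    have /setP/(_ i) := high0; rewrite [in LHS]inE iV /= in_set0 => /negbT.
    rewrite -ltnNge => /leq_trans; apply.
    have /setP/(_ j) := S_high; rewrite inE jS /= in_set0 => /negbT.
    by rewrite -leqNgt.
  by rewrite x_low // mulr0.
rewrite ffunE (_ : (_ == _) = false) ?mulr0 //; apply: contraNF nV => /eqP <-.
by rewrite (symdiffC V) symdiffK.
Qed.

Lemma low_high_symdiff d U S : low d S = set0 ->
  high d (symdiff U S) = symdiff (high d U) S.
Proof.
move=> /setP S_high; apply/setP => i; have := S_high i; rewrite !inE.
case: (i \in S) => //=; rewrite ?addbF // => ltF.
by rewrite [(d <= i)%N]leqNgt ltF !andbT.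
Qed.

Lemma low_symdiff d U S : low d S = set0 -> low d (symdiff U S) = low d U.
Proof.
move=> /setP S_high; apply/setP => i; have := S_high i; rewrite !inE.
by case: (i \in S) => //=; rewrite ?addbF // => ->; rewrite !andbF.
Qed.

Lemma low_id d U : high d U = set0 -> low d U = U.
Proof.
move=> /setP U_low; apply/setP => i; have := U_low i; rewrite !inE.
by case: (i \in U) => //= /negbT; rewrite -ltnNge.
Qed.

Lemma supported_symdiff d x S U : supported d x -> low d S = set0 ->
  x (symdiff U S) = if high d U == S then x (low d U) else 0.
Proof.
move=> x_low S_high; have [E|ne] := eqVneq (high d U) S.
  rewrite -(low_symdiff U S_high) low_id // low_high_symdiff // E.
  exact: symdiffss.
rewrite x_low // low_high_symdiff //; apply: contraNneq ne => E.
by rewrite -[S](symdiffK (high d U)) E symdiffs0.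
Qed.
End LowHighProduct.

(** * Matrix units in the Clifford algebra *)

Section MatrixUnits.
Variables (R : realType) (C : algType R) (g u h : C).

(** With [h = g u = - u g] and [p = (1 + g) / 2], one has [p u = (u + h) / 2] and
    [u p = (u - h) / 2]: [eps = 1] gives [x_b], and [eps = -1] gives [y_b]. *)
Definition unit_coef (eps : R) b : C :=
  match b with
  | 0%N => 2^-1 *: (1 + g)
  | 1%N => 2^-1 *: (u + eps *: h)
  | _ => 0
  end.

Hypotheses (gg : g * g = 1) (uu : u * u = 1).
Hypotheses (gu : g * u = h) (ug : u * g = - h).

Lemma unit_coefM b c : (b < 2)%N -> (c < 2)%N ->
  unit_coef 1 b * unit_coef (-1) c = if b == c then unit_coef 1 0 else 0.
Proof.
have gh : g * h = u by rewrite -gu mulrA gg mul1r.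
have hg : h * g = - u by rewrite -gu -mulrA ug mulrN gh.
have uh : u * h = - g by rewrite -gu mulrA ug mulNr -gu -mulrA uu mulr1.
have hu : h * u = g by rewrite -gu -mulrA uu mulr1.
have hh : h * h = -1 by rewrite -{2}gu mulrA hg mulNr uu.
have double (z : C) : 2^-1 *: (2^-1 *: (z + z)) = 2^-1 *: z.
  congr (_ *: _); rewrite -mulr2n -scaler_nat scalerA mulVf ?scale1r //.
  by rewrite pnatr_eq0.
case: b => [|[|]] // _; case: c => [|[|]] // _ /=;
  rewrite ?scale1r ?scaleN1r -scalerAl -scalerAr.
- rewrite mulrDl mul1r mulrDr mulr1 gg [g + 1]addrC; exact: double.
- by rewrite mulrDl mul1r mulrDr mulrN gu gh -[h - u]opprB subrr !scaler0.
- by rewrite mulrDr mulr1 mulrDl ug hg [- h - u]addrC -opprD subrr !scaler0.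
rewrite mulrDl !mulrDr !mulrN uu uh hu hh !opprK [g + 1]addrC; exact: double.
Qed.
End MatrixUnits.

(** * Products of five anticommuting square roots of 1 *)

Section Anticommute.
Variables (C : nzRingType).
Definition anti (x y : C) := x * y = - (y * x).

Lemma anti_sym x y : anti x y -> anti y x.
Proof. by rewrite /anti => ->; rewrite opprK. Qed.

Lemma anti_comm x y z : anti x y -> anti x z -> GRing.comm x (y * z).
Proof.
move=> xy xz; rewrite /GRing.comm mulrA xy mulNr -(mulrA y x) xz mulrN opprK.
by rewrite mulrA.
Qed.

Lemma anti_comm_mul x y z : anti x y -> GRing.comm x z -> anti x (y * z).
Proof. by move=> xy xz; rewrite /anti mulrA xy mulNr -(mulrA y x) xz mulrA. Qed.

(** Moving the second [w] past [d] changes the sign, which [w * w = -1] restores. *)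
Lemma anti_mul_cancel w d f :
  w * w = -1 -> anti w d -> w * d * (w * f) = d * f.
Proof.
move=> ww wd; rewrite -(mulrA w d) (mulrA d w f) -[d * w]opprK -wd.
by rewrite mulNr mulrN -(mulrA w d) (mulrA w w) ww mulN1r opprK.
Qed.

Variables a b c d f : C.
Hypotheses (aa : a * a = 1) (bb : b * b = 1) (cc : c * c = 1) (dd : d * d = 1)
  (ff : f * f = 1).
Hypotheses (ab : anti a b) (ac : anti a c) (ad : anti a d) (af : anti a f)
  (bc : anti b c) (bd : anti b d) (bf : anti b f) (cd : anti c d)
  (cf : anti c f)
  (df : anti d f).
Let w := a * b * c.

(** Since [a] commutes with [b * c], the square equals [(b * c) * (b * c)]. *)
Let ww : w * w = -1.
Proof.
have comm_a : GRing.comm a (b * c) by apply: anti_comm.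
rewrite /w -!mulrA [X in a * X]mulrA [(b * c) * _]mulrA -comm_a.
rewrite -!mulrA mulrA aa mul1r [c * _]mulrA -[c * b]opprK -bc.
by rewrite mulNr mulrN -mulrA cc mulr1 bb.
Qed.

Let anti_w z : anti a z -> anti b z -> anti c z -> anti w z.
Proof.
move=> az bz cz; apply: anti_sym; rewrite /w -mulrA.
by apply: anti_comm_mul; [|apply: anti_comm]; apply: anti_sym.
Qed.

Let wd : anti w d. Proof. exact: anti_w. Qed.
Let wf : anti w f. Proof. exact: anti_w. Qed.

(** Since [w] has three factors, it anticommutes with [d] and [f]. Hence it cancels from every
    product of two of [w * d] and [w * f]. *)
Lemma quad_relations : let g := w * d in let u := w * f in let h := d * f in
  [/\ g * g = 1, u * u = 1, g * u = h & u * g = - h].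
Proof.
split; rewrite ?(anti_mul_cancel d ww wd) ?(anti_mul_cancel f ww wd) //.
  by rewrite (anti_mul_cancel f ww wf).
by rewrite (anti_mul_cancel d ww wf); apply: anti_sym.
Qed.
End Anticommute.

Lemma comm_unit_coef (R : realType) (C : algType R) (g u h x : C) eps b :
  GRing.comm x g -> GRing.comm x u -> GRing.comm x h ->
  GRing.comm x (unit_coef g u h eps b).
Proof.
have commZ a (y : C) : GRing.comm x y -> GRing.comm x (a *: y).
  by rewrite /GRing.comm -scalerAl -scalerAr => ->.
move=> xg xu xh; case: b => [|[|b]] /=.
- by apply/commZ/commrD => //; apply: commr1.
- by apply/commZ/commrD => //; apply: commZ.
- exact: commr0.
Qed.

(** * The even elements [x_j], [y_j] and their coordinates *)

Section Elements.
Variables (R : realType) (m : nat).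
Notation CL := (clifford R m).
Implicit Types (eps : R) (S T U : {set 'I_m}) (s : seq nat).

(** Natural indices make the arithmetic of blocks easy; the value 0 out of range keeps
    anticommutation free of bounds. *)
Definition gen i : CL := if insub i is Some k then clgen R k else 0.

Lemma gen_sqr i : (i < m)%N -> gen i * gen i = 1.
Proof. by move=> lti; rewrite /gen insubT clgen_sqr. Qed.

Lemma gen_anti i j : i != j -> anti (gen i) (gen j).
Proof.
rewrite /anti /gen.
case: insubP => [i' _ <-|_]; last by rewrite mul0r mulr0 oppr0.
case: insubP => [j' _ <-|_]; last by rewrite mul0r mulr0 oppr0.
exact: clgen_anticomm.
Qed.

Definition seqset s : {set 'I_m} := [set i : 'I_m | val i \in s].

Lemma seqset_cons i s (lti : (i < m)%N) :
  seqset (i :: s) = Ordinal lti |: seqset s.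
Proof. by apply/setP => j; rewrite !inE. Qed.

Lemma prod_gen s : sorted ltn s -> all (ltn^~ m) s ->
  \prod_(i <- s) gen i = clbasis R (seqset s).
Proof.
elim: s => [_ _|i s IHs path_s /= /andP[lti ltm]].
  by rewrite big_nil; congr clbasis; apply/setP => j; rewrite !inE.
have /allP lt_i := order_path_min ltn_trans path_s.
rewrite big_cons IHs ?(path_sorted path_s) // /gen insubT clbasisM csign_lt.
  rewrite scale1r seqset_cons; congr clbasis; apply/setP => j; rewrite !inE.
  by case: eqP => //= ->; apply/negP => /lt_i /=; rewrite ltnn.
by move=> a b; rewrite !inE => /eqP-> /lt_i.
Qed.

Lemma subset_code_seqset s : uniq s -> all (ltn^~ m) s ->
  subset_code (seqset s) = (\sum_(i <- s) 2 ^ i)%N.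
Proof.
elim: s => [_ _|i s IHs /= /andP[nis us] /andP[lti ltm]].
  by rewrite big_nil /subset_code big_pred0 // => i; rewrite !inE.
rewrite big_cons -IHs // (seqset_cons _ lti) /subset_code big_setU1 //=.
by rewrite inE.
Qed.

Lemma odd_card_clbasisM S T : odd #|S| = odd #|T| ->
  clbasis R S * clbasis R T \in @cleven R m.
Proof.
move=> E; rewrite clbasisM rpredZ //; apply/clevenP => U oU.
rewrite ffunE; case: eqP => // EU.
by move: oU; rewrite EU odd_card_symdiff E addbb.
Qed.

Lemma gen2_even i j : gen i * gen j \in @cleven R m.
Proof.
rewrite /gen; case: insub => [i'|]; last by rewrite mul0r rpred0.
case: insub => [j'|]; last by rewrite mulr0 rpred0.
by apply: odd_card_clbasisM; rewrite !cards1.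
Qed.

Definition gen_g k : CL :=
  gen (5 * k) * gen (5 * k + 1) * gen (5 * k + 2) * gen (5 * k + 3).
Definition gen_u k : CL :=
  gen (5 * k) * gen (5 * k + 1) * gen (5 * k + 2) * gen (5 * k + 4).
Definition gen_h k : CL := gen (5 * k + 3) * gen (5 * k + 4).

Definition factor eps k b : CL := unit_coef (gen_g k) (gen_u k) (gen_h k) eps b.

Lemma gen_relations k : (5 * k + 5 <= m)%N ->
  [/\ gen_g k * gen_g k = 1, gen_u k * gen_u k = 1,
      gen_g k * gen_u k = gen_h k & gen_u k * gen_g k = - gen_h k].
Proof.
move=> le_m; apply: quad_relations; (try by apply: gen_sqr; lia);
  by apply: gen_anti; lia.
Qed.

(** The factor combines products of an even number of generators of its block, and an outside
    generator anticommutes with each of these. *)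
Lemma comm_gen_factor i eps k b :
  (i < 5 * k)%N || (5 * k + 5 <= i)%N -> GRing.comm (gen i) (factor eps k b).
Proof.
move=> i_out.
have anti_i j : (5 * k <= j < 5 * k + 5)%N -> anti (gen i) (gen j).
  by move=> j_in; apply: gen_anti; lia.
have comm2 j j' : (5 * k <= j < 5 * k + 5)%N -> (5 * k <= j' < 5 * k + 5)%N ->
    GRing.comm (gen i) (gen j * gen j').
  by move=> /anti_i ij /anti_i; apply: anti_comm.
apply: comm_unit_coef; rewrite /gen_g /gen_u -?(mulrA (_ * _));
  [apply: commrM|apply: commrM|]; apply: comm2; lia.
Qed.

Lemma comm_factor eps eps' k k' b b' : (k' < k)%N ->
  GRing.comm (factor eps k b) (factor eps' k' b').
Proof.
move=> ltk; have comm1 j : (5 * k' <= j < 5 * k' + 5)%N ->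
    GRing.comm (factor eps k b) (gen j).
  by move=> j_in; apply/commr_sym/comm_gen_factor; lia.
by apply: comm_unit_coef; rewrite /gen_g /gen_u /gen_h;
  repeat apply: commrM; apply: comm1; lia.
Qed.

Lemma factor_even eps k b : factor eps k b \in @cleven R m.
Proof.
have g_even : gen_g k \in @cleven R m.
  by rewrite /gen_g -mulrA rpredM ?gen2_even.
have u_even : gen_u k \in @cleven R m.
  by rewrite /gen_u -mulrA rpredM ?gen2_even.
have h_even : gen_h k \in @cleven R m by rewrite gen2_even.
case: b => [|[|b]]; rewrite /factor /= ?rpred0 //.
  by rewrite rpredZ ?rpredD ?rpred1.
by rewrite rpredZ ?rpredD ?rpredZ.
Qed.

(** This is [x_j] for [eps = 1] and [y_j] for [eps = -1], with [j] split into digits as in [table];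
    [element 1 k 0] is the idempotent [P]. *)
Fixpoint element eps k j : CL :=
  if k is k'.+1 then
    element eps k' (j %% 2 ^ k')%N * factor eps k' (j %/ 2 ^ k')%N
  else (j == 0%N)%:R.

Lemma element0 eps k : element eps k 0 = element 1 k 0.
Proof. by elim: k => //= k IHk; rewrite mod0n div0n IHk. Qed.

Lemma element_even eps k j : element eps k j \in @cleven R m.
Proof.
elim: k j => [|k IHk] j /=; first exact: rpred_nat.
by rewrite rpredM ?IHk ?factor_even.
Qed.

Lemma comm_factor_element eps eps' k k' b j : (k' <= k)%N ->
  GRing.comm (factor eps k b) (element eps' k' j).
Proof.
elim: k' j => [|k' IHk] j ltk /=; first exact: commr_nat.
by apply: commrM; [apply: IHk; apply: ltnW|apply: comm_factor].
Qed.

(** The top factor of [x_i] commutes with the lower part of [y_j], so the product splits into one of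
    lower elements and one of matrix units in the top block. *)
Lemma elementM k i j : (5 * k <= m)%N -> (i < 2 ^ k)%N -> (j < 2 ^ k)%N ->
  element 1 k i * element (-1) k j = if i == j then element 1 k 0 else 0.
Proof.
elim: k i j => [|k IHk] i j le_m.
  by case: i => // _; case: j => // _; rewrite /= mulr1.
move=> lti ltj /=.
have K0 : (0 < 2 ^ k)%N by rewrite expn_gt0.
rewrite -mulrA [factor _ _ _ * _]mulrA comm_factor_element // -!mulrA mulrA.
have le_k : (5 * k + 5 <= m)%N by lia.
have [gg uu gu ug] := gen_relations le_k.
rewrite IHk ?ltn_mod //; last by lia.
rewrite unit_coefM ?ltn_divLR -?expnS //.
rewrite [in RHS](divn_eq i (2 ^ k)) [in RHS](divn_eq j (2 ^ k)).
rewrite eq_addr ?ltn_mod // mod0n div0n andbC.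
by case: eqP => _ /=; [case: eqP => _ //|]; rewrite ?mulr0 ?mul0r.
Qed.

Lemma high_seqset d s : all (leq d) s -> low d (seqset s) = set0.
Proof.
move=> /allP le_d; apply/setP => i; rewrite !inE.
by apply/negP => /andP[/le_d le_di]; rewrite ltnNge le_di.
Qed.

Lemma high_eq d T S t : subset_code S = (t * 2 ^ d)%N ->
  (high d T == S) = (subset_code T %/ 2 ^ d == t)%N.
Proof.
move=> code_S; rewrite -(inj_eq (@subset_code_inj m)) subset_code_high code_S.
by rewrite eqn_pmul2r ?expn_gt0.
Qed.

Lemma high_neq0 d T : high d T != set0 -> (2 ^ d <= subset_code T)%N.
Proof.
case/set0Pn => i; rewrite inE => /andP[iT le_di].
rewrite /subset_code (bigD1 i) //=; apply: leq_trans (leq_addr _ _).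
by rewrite leq_exp2l.
Qed.

Lemma expn32 k : (32 ^ k = 2 ^ (5 * k))%N.
Proof. by rewrite expnM. Qed.

Definition block k s := seqset (map (addn (5 * k)) s).

Lemma blockE k s : (5 * k + 5 <= m)%N -> sorted ltn s -> all (ltn^~ 5) s ->
  [/\ low (5 * k) (block k s) = set0,
      subset_code (block k s) = ((\sum_(i <- s) 2 ^ i) * 2 ^ (5 * k))%N &
      \prod_(i <- s) gen (5 * k + i) = clbasis R (block k s)].
Proof.
move=> le_m sort_s lt5.
have sort_s' : sorted ltn (map (addn (5 * k)) s).
  by rewrite sorted_map; apply: sub_sorted sort_s => i j; rewrite /= ltn_add2l.
have lt_m : all (ltn^~ m) (map (addn (5 * k)) s).
  rewrite all_map; apply: sub_all lt5 => i /= lti.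
  by apply: leq_trans le_m; rewrite ltn_add2l.
split.
- by apply: high_seqset; rewrite all_map; apply/allP => i _ /=; apply: leq_addr.
- rewrite subset_code_seqset //; last first.
    exact: sorted_uniq ltn_trans ltnn _ sort_s'.
  by rewrite big_map big_distrl; apply: eq_bigr => i _; rewrite expnD mulnC.
by rewrite -prod_gen // big_map.
Qed.

Lemma element_supported eps k j :
  (forall T, element eps k j T = table eps k j (subset_code T)) ->
  supported (5 * k) (element eps k j).
Proof.
by move=> tab T /high_neq0 le_T; rewrite tab table_out // expn32 le_T orbT.
Qed.

Lemma factor_clbasis eps k b : (5 * k + 5 <= m)%N -> factor eps k b =
  match b with
  | 0%N => 2^-1 *: (clbasis R (block k [::])
                    + clbasis R (block k [:: 0; 1; 2; 3]%N))
  | 1%N => 2^-1 *: (clbasis R (block k [:: 0; 1; 2; 4]%N)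
                    + eps *: clbasis R (block k [:: 3; 4]%N))
  | _ => 0
  end.
Proof.
move=> le_m; have E s := @blockE k s le_m.
have [_ _ <-] := E [::] isT isT; have [_ _ <-] := E [:: 0; 1; 2; 3]%N isT isT.
have [_ _ <-] := E [:: 0; 1; 2; 4]%N isT isT.
have [_ _ <-] := E [:: 3; 4]%N isT isT.
by rewrite !big_cons !big_nil !mulr1 addn0 /factor /gen_g /gen_u /gen_h -!mulrA.
Qed.

Lemma clscaleE (a : R) (x : CL) T : (a *: x) T = a * x T.
Proof. by rewrite ffunE. Qed.

Lemma claddE (x y : CL) T : (x + y) T = x T + y T.
Proof. by rewrite ffunE. Qed.

Lemma cl1E T : (1 : CL) T = (T == set0)%:R.
Proof. by rewrite -[1]/(clbasis R set0) ffunE. Qed.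

(** Multiplying by a basis element of block [k] moves the old coordinates, without sign, to the
    codes with a prescribed quotient by [2 ^ (5 * k)]. The quotients 0, 15, 23, 24 are those of
    [coef]. *)
Lemma element_table eps k j T : (5 * k <= m)%N ->
  element eps k j T = table eps k j (subset_code T).
Proof.
elim: k j T => [|k IHk] j T le_m.
  have code0 : subset_code (set0 : {set 'I_m}) = 0%N.
    by rewrite /subset_code big_set0.
  have -> : table eps 0 j (subset_code T) = ((j == 0%N) && (T == set0))%:R.
    by rewrite -(inj_eq (@subset_code_inj m)) code0.
  by case: j => [|j] /=; rewrite ?cl1E // ffunE.
have le_k : (5 * k + 5 <= m)%N by lia.
have {}IHk j' T' : element eps k j' T' = table eps k j' (subset_code T').
  by apply: IHk; lia.
rewrite [element _ _ _]/= factor_clbasis // [RHS]/= expn32.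
have coord j' s : sorted ltn s -> all (ltn^~ 5%N) s ->
    (element eps k j' * clbasis R (block k s)) T =
    table eps k j' (subset_code T %% 2 ^ (5 * k))%N
      * (subset_code T %/ 2 ^ (5 * k) == \sum_(i <- s) 2 ^ i)%N%:R.
  move=> sort_s lt5; have [low0 code_s _] := blockE le_k sort_s lt5.
  have supp := element_supported (IHk j').
  rewrite (clmul_clbasis _ supp low0) (supported_symdiff _ supp low0).
  rewrite (high_eq _ code_s) subset_code_mod -IHk.
  by case: eqP; rewrite ?mulr1 ?mulr0.
case: (j %/ 2 ^ k)%N => [|[|b]] /=; last by rewrite !mulr0 ffunE.
- rewrite -scalerAr clscaleE mulrDr claddE !coord // !big_cons !big_nil.
  rewrite -mulrDr mulrCA [2^-1 * _]mulrC; congr (_ * (_ / _)).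
  by case: eqP => [->|_] //=; rewrite ?addr0 ?add0r.
- rewrite -scalerAr clscaleE mulrDr claddE -scalerAr clscaleE.
  rewrite !coord // !big_cons !big_nil.
  by rewrite mulrCA -mulrDr mulrCA [2^-1 * _]mulrC.
Qed.

(** A new block turns [P] into [(P + P e_G) / 2]. Both summands have the same sum of squares and
    their supports are disjoint, so this sum is multiplied by 2 / 4. *)
Lemma element_norm k : (5 * k <= m)%N ->
  \sum_T element 1 k 0 T ^+ 2 = 1 / 2 ^+ k :> R.
Proof.
elim: k => [|k IHk] le_m.
  rewrite /= divr1 (bigD1 set0) //= cl1E eqxx expr1n big1 ?addr0 // => T.
  move=> /negPf nT.
  by rewrite cl1E nT expr0n.
have le_k : (5 * k + 5 <= m)%N by lia.
have supp : supported (5 * k) (element 1 k 0).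
  by apply: element_supported => T; apply: element_table; lia.
have [low0 code0 _] := @blockE k [::] le_k isT isT.
have [lowG codeG _] := @blockE k [:: 0; 1; 2; 3]%N le_k isT isT.
set G := block k [:: 0; 1; 2; 3]%N in lowG codeG *.
have G_neq0 : G != set0.
  apply/eqP => G0; move: codeG; rewrite G0 /subset_code big_set0 !big_cons big_nil.
  by move/eqP; rewrite eq_sym muln_eq0 expn_eq0.
have eltS : element 1 k.+1 0 = element 1 k 0 * factor 1 k 0.
  by rewrite /= mod0n div0n.
rewrite eltS factor_clbasis // -/G.
have step T :
    (element 1 k 0 * (2^-1 *: (clbasis R (block k [::]) + clbasis R G))) T ^+ 2
    = 4^-1 * (element 1 k 0 T ^+ 2 + element 1 k 0 (symdiff T G) ^+ 2).
  rewrite -scalerAr clscaleE mulrDr claddE !(clmul_clbasis _ supp) //.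
  have -> : block k [::] = set0 :> {set 'I_m} by apply/setP => i; rewrite !inE.
  rewrite symdiffs0 exprMn sqrrD.
  have -> : element 1 k 0 T * element 1 k 0 (symdiff T G) = 0.
    rewrite (supported_symdiff _ supp lowG).
    case: eqP => [E|_]; last by rewrite mulr0.
    by rewrite supp ?mul0r // E.
  by rewrite mul0rn addr0 exprVn -natrX.
rewrite (eq_bigr _ (fun T _ => step T)) -big_distrr big_split /=.
have symG_inj : injective (fun T => symdiff T G).
  by move=> T U; rewrite /= ![symdiff _ G]symdiffC => /(can_inj (symdiffK G)).
have -> : \sum_T element 1 k 0 (symdiff T G) ^+ 2 = \sum_T element 1 k 0 T ^+ 2.
  by rewrite [RHS](reindex_inj symG_inj).
rewrite IHk; last by lia.
rewrite exprS; field.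
by rewrite expf_neq0 ?pnatr_eq0.
Qed.
End Elements.

(** * Conclusion *)

Definition entries (R : realType) n (A : 'M[R]_n) : nat -> R :=
  nth 0 [seq A i j | i <- enum 'I_n, j <- enum 'I_n].

Lemma entriesE (R : realType) n (A : 'M[R]_n) (i j : 'I_n) :
  entries A (i * n + j) = A i j.
Proof.
rewrite /entries; set s := enum 'I_n.
have size_s : size s = n by rewrite size_enum_ord.
have nth_s (k : 'I_n) : nth i s k = k by rewrite nth_ord_enum.
have ltis : (i < size s)%N by rewrite size_s.
have row (r : seq 'I_n) k : (k < size r)%N ->
    nth 0 [seq A i j | i <- r, j <- s] (k * n + j) = A (nth i r k) j.
  elim: r k => [|i' r IHr] [|k] //= ltk; rewrite nth_cat size_map size_s.
    by rewrite mul0n add0n ltn_ord (nth_map i) ?size_s ?nth_s.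
  rewrite mulSn -addnA ltnNge leq_addr /= addKn; exact: IHr.
by rewrite row // nth_s.
Qed.

Lemma input_stateE (R : realType) n (A : 'M[R]_n) :
  input_state A = mk (n :: nseq 14 0%N)
    (input_arrays (entries A)).
Proof.
congr State; apply: functional_extensionality => x.
  by do 15 case: x => [|x] //; rewrite /= nth_nil.
apply: functional_extensionality => k.
by do 5 case: x => [|x] //; rewrite /= nth_nil.
Qed.

Lemma clnorm_sqr_scale (R : rcfType) m (a : R) (x : clifford R m) :
  clnorm (a *: x) ^+ 2 = a ^+ 2 * \sum_T x T ^+ 2.
Proof.
rewrite sqr_sqrtr; last by apply: sumr_ge0 => T _; apply: sqr_ge0.
by rewrite mulr_sumr; apply: eq_bigr => T _; rewrite ffunE exprMn.
Qed.

Unset Implicit Arguments.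

Theorem theorem5p3 (R : realType) :
  exists (P : program) (c k : nat),
  forall (l n m : nat), n = (2 ^ l)%N -> m = (5 * l)%N ->
  forall A : 'M[R]_n,
  exists (t : nat) (s : state R) (B : 'M[clifford R m]_(2 * n)),
    [/\ halts_in P (input_state A) t s,
        (t <= c * n ^ k)%N,
        outputs s B,
        B \is a mxOver (@cleven R m)
      & clnorm (Cdet B) ^+ 2 = permanent A ^+ 2 / 2 ^+ l].
Proof.
exists perm_program, 100, 7 => l _ _ -> -> A.
have [t [s [le_t halts [r [O [X [Y [def_s _ _ hO]]]]]]]] :=
  runs_halts (runs_perm_program l (entries A)).
pose x (j : 'I_(2 ^ l)) := @element R (5 * l) 1 l j.
pose y (j : 'I_(2 ^ l)) := @element R (5 * l) (-1) l j.
exists t, s, (dbl_mx A x y); split=> //.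
- by rewrite input_stateE.
- move=> i j T; have ltT : (subset_code T < 32 ^ l)%N.
    rewrite expn32 -[T](@low_id _ (5 * l)) ?subset_code_low_lt //.
    by apply/setP => k; rewrite !inE leqNgt ltn_ord andbF.
  rewrite def_s /= -expn32 hO //.
  have lti := ltn_ord (ord_half i); have ltj := ltn_ord (ord_half j).
  (* The counter has reached [n * n * M], so every position counts as processed. *)
  rewrite ifT; last first.
    have lt_ij : (i./2 * 2 ^ l + j./2 < 2 ^ l * 2 ^ l)%N.
      apply: (@leq_trans (i./2.+1 * 2 ^ l)); last by rewrite leq_mul2r lti orbT.
      by rewrite (mulSnr i./2) ltn_add2l.
    apply: (@leq_trans ((i./2 * 2 ^ l + j./2).+1 * 32 ^ l)).
      by rewrite (mulSnr (i./2 * 2 ^ l + j./2)%N) ltn_add2l.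
    by rewrite leq_mul2r lt_ij orbT.
  rewrite mxE /out_entry; case: ifP => _; first by rewrite ffunE.
  case: ifP => _; first by rewrite /y element_table.
  by rewrite /x clscaleE element_table //
    -(entriesE A (ord_half i) (ord_half j)).
- apply/mxOverP => i j; rewrite mxE.
  case: ifP => _; first exact: rpred0.
  case: ifP => _; first exact: element_even.
  exact/rpredZ/element_even.
rewrite (@Cdet_dbl_mx _ _ _ A x y (@element R (5 * l) 1 l 0)) ?expn_gt0 //.
- by rewrite clnorm_sqr_scale element_norm // mul1r.
(* [P] is idempotent because [x_0 = y_0 = P], so that [P * P] is [x_0 y_0]. *)
- by rewrite -{2}(@element0 R (5 * l) (-1) l) elementM ?expn_gt0.
by move=> i j; rewrite elementM // -val_eqE.
Qed.
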